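(* Let $n,m\ge 1$, $A\in\mathbb{R}^{n\times n}$, $B\in\mathbb{R}^{n\times m}$, and assume that $\operatorname{Re}\lambda\le 0$ for every $\lambda\in\sigma(A)$ and that $\operatorname{rank}(B,AB,\ldots,A^{n-1}B)=n$. Then the following statements are equivalent. (i) $(A,B)$ has the exact truncation property: for every $x\in\mathbb{R}^n\setminus\{0\}$ there exists $\varepsilon_x\in(0,|x|)$ such that $$u_{\varepsilon,x}^*(t)=u_{0,x}^*(t)\qquad\text{for all } 0<t\le T_\varepsilon^*(x)\text{ and all }0<\varepsilon<\varepsilon_x .$$ (ii) There exist constants $\beta>0$ and $a\le 0$ such that $$BB^\top=\beta I_n,\qquad A+A^\top=2aI_n .$$ (iii) There exists a function $\Psi:[0,\infty)\to[0,\infty)$ with $\Psi(0)=0$ such that $V_0(x)=\Psi(|x|)$ for all $x\in\mathbb{R}^n$. Moreover, once any of these equivalent conditions holds, the equality $u_{\varepsilon,x}^*(t)=u_{0,x}^*(t)$ for all $0<t\le T_\varepsilon^*(x)$ holds for every $x\ne 0$ and every $0<\varepsilon<|x|$.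
   Context: $|\cdot|$ is the Euclidean norm. Consider the control system $\dot z(t)=Az(t)+Bu(t)$, $z(0)=x$, with controls in $\mathcal U_{ad}=\{u\in L^\infty(0,\infty;\mathbb{R}^m):\|u\|_{L^\infty(0,\infty;\mathbb{R}^m)}\le 1\}$ (pointwise Euclidean norm at most $1$ a.e.); $z(\cdot;x,u)$ denotes its solution. Let $\overline B_\varepsilon(0)=\{y\in\mathbb{R}^n:|y|\le\varepsilon\}$ for $\varepsilon\ge0$ (so $\overline B_0(0)=\{0\}$). For $x\ne0$ and $0\le\varepsilon<|x|$ the minimum-time problem $(P_{\varepsilon,x})$ has optimal time $$T_\varepsilon^*(x)=\inf\{T>0: z(T;x,u)\in\overline B_\varepsilon(0)\text{ for some }u\in\mathcal U_{ad}\},$$ and $u\in\mathcal U_{ad}$ is optimal for $(P_{\varepsilon,x})$ if $z(T_\varepsilon^*(x);x,u)\in\overline B_\varepsilon(0)$. Under the stated hypotheses on $(A,B)$, it is standard that $T_\varepsilon^*(x)$ is finite and that an optimal control exists and is unique up to a.e. equality on $(0,T_\varepsilon^*(x))$; it has a unique representative on $(0,T_\varepsilon^*(x)]$ that is piecewise continuous and left-continuous with finitely many discontinuities. $u_{\varepsilon,x}^*$ denotes this representative, extended by $0$ to $(T_\varepsilon^*(x),\infty)$. The point-target minimum-time function is $V_0(x)=T_0^*(x)$ for $x\ne0$ and $V_0(0)=0$. *)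

(* Defs.v *)
From HB Require Import structures.
From mathcomp Require Import all_boot all_order all_algebra.
From mathcomp Require Import all_classical all_reals all_analysis.
From mathcomp Require Import complex.

Set Implicit Arguments.
Unset Strict Implicit.
Unset Printing Implicit Defensive.

Import Order.TTheory GRing.Theory Num.Theory.
Import numFieldNormedType.Exports.

Local Open Scope classical_set_scope.
Local Open Scope ring_scope.

(* The norm that MathComp-Analysis puts on matrices is the sup norm, hence
   this separate Euclidean norm; the topology on 'cV[R]_n is the same. *)
Definition enorm (R : realType) (n : nat) (x : 'cV[R]_n) : R :=
  Num.sqrt (\sum_(i < n) x i 0 ^+ 2).

Definition spectrum_nonpos (R : realType) (n : nat) (A : 'M[R]_n) : Prop :=
  forall l : complex R,
    eigenvalue (map_mx (real_complex R) A) l -> complex.Re l <= 0.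

Definition kalman (R : realType) (n m : nat)
    (A : 'M[R]_n) (B : 'M[R]_(n, m)) : 'M[R]_(n, \sum_(k < n) m) :=
  \mxrow_(k < n) (A ^+ k *m B).

(* Controls are functions on the whole of R; only their values on ]0, +oo[
   matter. *)
Definition admissible (R : realType) (m : nat) (u : R -> 'cV[R]_m) : Prop :=
  (forall i : 'I_m, measurable_fun (`]0, +oo[ : set R) (fun t => u t i 0)) /\
  {ae lebesgue_measure, forall t : R, 0 < t -> enorm (u t) <= 1}.

(* Caratheodory solution of z' = A z + B u, z(0) = x, in integral form. For
   admissible u and continuous z the integrand is bounded and measurable on
   [0, t], so that the integral is a genuine one. *)
Definition solution (R : realType) (n m : nat)
    (A : 'M[R]_n) (B : 'M[R]_(n, m)) (x : 'cV[R]_n)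
    (u : R -> 'cV[R]_m) (z : R -> 'cV[R]_n) : Prop :=
  {within (`[0, +oo[ : set R), continuous z} /\
  forall t : R, 0 <= t -> forall i : 'I_n,
    z t i 0 =
    x i 0 + \int[lebesgue_measure]_(s in `[0, t]) ((A *m z s + B *m u s) i 0).

Definition steers (R : realType) (n m : nat)
    (A : 'M[R]_n) (B : 'M[R]_(n, m)) (eps : R) (x : 'cV[R]_n)
    (u : R -> 'cV[R]_m) (T : R) : Prop :=
  exists z : R -> 'cV[R]_n, solution A B x u z /\ enorm (z T) <= eps.

(* The real-valued [inf] is the true infimum as soon as the set is nonempty,
   which holds when A has its spectrum in the closed left half-plane and
   (A, B) satisfies the rank condition. *)
Definition opt_time (R : realType) (n m : nat)
    (A : 'M[R]_n) (B : 'M[R]_(n, m)) (eps : R) (x : 'cV[R]_n) : R :=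
  inf [set T : R | 0 < T /\
    exists u : R -> 'cV[R]_m, admissible u /\ steers A B eps x u T].

Definition optimal (R : realType) (n m : nat)
    (A : 'M[R]_n) (B : 'M[R]_(n, m)) (eps : R) (x : 'cV[R]_n)
    (u : R -> 'cV[R]_m) : Prop :=
  admissible u /\ steers A B eps x u (opt_time A B eps x).

Definition pw_left_continuous (R : realType) (m : nat) (T : R)
    (u : R -> 'cV[R]_m) : Prop :=
  [/\ forall t : R, 0 < t <= T -> u s @[s --> t^'-] --> u t,
      forall t : R, 0 <= t < T ->
        exists l : 'cV[R]_m, u s @[s --> t^'+] --> l
    & exists D : seq R, forall t : R,
        0 < t < T -> t \notin D -> {for t, continuous u}].

Definition opt_repr (R : realType) (n m : nat)
    (A : 'M[R]_n) (B : 'M[R]_(n, m)) (eps : R) (x : 'cV[R]_n)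
    (u : R -> 'cV[R]_m) : Prop :=
  [/\ optimal A B eps x u,
      pw_left_continuous (opt_time A B eps x) u
    & forall t : R, ~~ (0 < t <= opt_time A B eps x) -> u t = 0].

(* Under the spectral and rank assumptions exactly one function satisfies
   [opt_repr A B eps x] when 0 <= eps < |x|, and it is the one selected here;
   the default value 0 is then not used. *)
Definition opt_control (R : realType) (n m : nat)
    (A : 'M[R]_n) (B : 'M[R]_(n, m)) (eps : R) (x : 'cV[R]_n) :
    R -> 'cV[R]_m :=
  xget (fun _ => 0) [set u | opt_repr A B eps x u].

Definition V0 (R : realType) (n m : nat)
    (A : 'M[R]_n) (B : 'M[R]_(n, m)) (x : 'cV[R]_n) : R :=
  if x == 0 then 0 else opt_time A B 0 x.

Definition truncation_at (R : realType) (n m : nat)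
    (A : 'M[R]_n) (B : 'M[R]_(n, m)) (x : 'cV[R]_n) (eps : R) : Prop :=
  forall t : R, 0 < t <= opt_time A B eps x ->
    opt_control A B eps x t = opt_control A B 0 x t.

Definition exact_truncation (R : realType) (n m : nat)
    (A : 'M[R]_n) (B : 'M[R]_(n, m)) : Prop :=
  forall x : 'cV[R]_n, x != 0 ->
    exists epsx : R, 0 < epsx < enorm x /\
      forall eps : R, 0 < eps < epsx -> truncation_at A B x eps.

Definition isotropic (R : realType) (n m : nat)
    (A : 'M[R]_n) (B : 'M[R]_(n, m)) : Prop :=
  exists beta a : R, [/\ 0 < beta, a <= 0,
    B *m B^T = beta%:M & A + A^T = (2 * a)%:M].

Definition radial_value (R : realType) (n m : nat)
    (A : 'M[R]_n) (B : 'M[R]_(n, m)) : Prop :=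
  exists Psi : R -> R, [/\ forall r : R, 0 <= r -> 0 <= Psi r,
    Psi 0 = 0 & forall x : 'cV[R]_n, V0 A B x = Psi (enorm x)].

(* Main.v *)
(** Extremals come from a covector [xi]: the control [bang xi] minimizes the pairing
  with the switching function [Q s = B^T exp(-sA)^T xi] pointwise. Pairing a trajectory
  with the costate gives [<xi, x> <= eps |exp(-tA)^T xi| + int_0^t |Q|] whenever [x] can
  be steered to the ball of radius [eps] in time [t], and equality characterizes
  [bang xi]. So optimality of explicit extremals, and uniqueness, follow without any
  existence theorem.

  If truncation is exact, the extremal to the origin is also optimal for the balls; the
  costate there is the inner normal [- z], and [z] is close to [- (T - t) B u(T)] near
  the final time [T]. Letting the radius tend to 0 gives [B^T] injective (by an extremal
  that switches just before [T]), then [B B^T] scalar (every covector is an eigenvector),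
  then [A + A^T] scalar (comparing state and costate to second order at [T]).

  If the value function is radial, the integrals [int_0^T |B^T exp(-sA)^T xi|] for small
  [T] agree on all unit covectors [xi]; compare them to first and second order at 0.

  If the system is isotropic, [exp(tA)] is a homothety times a rotation and every optimal
  control points to the origin along the rotated initial direction. *)

(* [opt_control] is an [xget] with default 0, so an equality of selected controls carries no
   information until a representative is known to exist. For extremals one is exhibited, which
   requires one-sided limits where the switching function vanishes; this is why the extremals used
   have at most one switching time. For the ball problems existence is read off from the truncation
   identity itself: the default 0 cannot agree with a control of norm one.

   Costates are chosen first and initial points computed backwards from the origin, so no costate
   has to be found for a given point. The first-order condition for the ball comes from a convex
   variation of the control.

   A switch is needed for the injectivity of [B^T] because extremals without a switch only constrain
   vectors in the range of [B^T]: a covector in the kernel leaves no trace there. Perturbing it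
   along its adjoint derivative makes that derivative visible as a reversal of the control. *)
Require Import Defs.
From HB Require Import structures.
From mathcomp Require Import all_boot all_order all_algebra.
From mathcomp Require Import all_classical all_reals all_analysis.
From mathcomp Require Import measurable_realfun.
From mathcomp Require Import complex.
From mathcomp Require Import ring lra.

Set Implicit Arguments.
Unset Strict Implicit.
Unset Printing Implicit Defensive.

Import Order.TTheory GRing.Theory Num.Theory.
Import numFieldNormedType.Exports.

Local Open Scope classical_set_scope.
Local Open Scope ring_scope.

(** * Euclidean geometry of column vectors *)

Section Euclid.
Context {R : realType}.

Definition dot {n : nat} (x y : 'cV[R]_n) : R := \sum_i x i 0 * y i 0.

Lemma dotE n (x y : 'cV[R]_n) : dot x y = (x^T *m y) 0 0.
Proof. by rewrite mxE; apply: eq_bigr => i _; rewrite mxE. Qed.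

Lemma dotC n (x y : 'cV[R]_n) : dot x y = dot y x.
Proof. by apply: eq_bigr => i _; rewrite mulrC. Qed.

Lemma dotDl n (x y z : 'cV[R]_n) : dot (x + y) z = dot x z + dot y z.
Proof. by rewrite !dotE linearD mulmxDl mxE. Qed.

Lemma dotDr n (x y z : 'cV[R]_n) : dot x (y + z) = dot x y + dot x z.
Proof. by rewrite dotC dotDl !(dotC x). Qed.

Lemma dotZl n c (x y : 'cV[R]_n) : dot (c *: x) y = c * dot x y.
Proof. by rewrite !dotE linearZ /= -scalemxAl mxE. Qed.

Lemma dotZr n c (x y : 'cV[R]_n) : dot x (c *: y) = c * dot x y.
Proof. by rewrite dotC dotZl dotC. Qed.

Lemma dotNl n (x y : 'cV[R]_n) : dot (- x) y = - dot x y.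
Proof. by rewrite -scaleN1r dotZl mulN1r. Qed.

Lemma dotNr n (x y : 'cV[R]_n) : dot x (- y) = - dot x y.
Proof. by rewrite dotC dotNl dotC. Qed.

Lemma dotBl n (x y z : 'cV[R]_n) : dot (x - y) z = dot x z - dot y z.
Proof. by rewrite dotDl dotNl. Qed.

Lemma dotBr n (x y z : 'cV[R]_n) : dot x (y - z) = dot x y - dot x z.
Proof. by rewrite dotDr dotNr. Qed.

Lemma dot0l n (x : 'cV[R]_n) : dot 0 x = 0.
Proof. by rewrite dotE linear0 mul0mx mxE. Qed.

Lemma dot0r n (x : 'cV[R]_n) : dot x 0 = 0.
Proof. by rewrite dotC dot0l. Qed.

Lemma dot_mulmxl n p (M : 'M[R]_(n, p)) x y : dot (M *m x) y = dot x (M^T *m y).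
Proof. by rewrite !dotE trmx_mul mulmxA. Qed.

Lemma dot_mulmxr n p (M : 'M[R]_(n, p)) x y : dot x (M *m y) = dot (M^T *m x) y.
Proof. by rewrite dot_mulmxl trmxK. Qed.

Lemma dot_delta n i (y : 'cV[R]_n) : dot (delta_mx i 0) y = y i 0.
Proof.
rewrite /dot (bigD1 i) //= big1 ?addr0 ?mxE ?eqxx ?mul1r// => j ji.
by rewrite mxE (negbTE ji) mul0r.
Qed.

Lemma dotvv_ge0 n (x : 'cV[R]_n) : 0 <= dot x x.
Proof. by apply: sumr_ge0 => i _; rewrite -expr2 sqr_ge0. Qed.

Lemma dotvv_eq0 n (x : 'cV[R]_n) : (dot x x == 0) = (x == 0).
Proof.
apply/idP/eqP => [|->]; last by rewrite dot0l.
rewrite psumr_eq0 => [/allP x0|i _]; last by rewrite -expr2 sqr_ge0.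
apply/matrixP => i j; rewrite ord1 mxE; apply/eqP.
by have := x0 i (mem_index_enum _); rewrite /= mulf_eq0 orbb.
Qed.

Lemma dot_inj n (x y : 'cV[R]_n) : (forall z, dot z x = dot z y) -> x = y.
Proof.
move=> xy; apply/eqP; rewrite -subr_eq0 -dotvv_eq0 dotBr.
by rewrite xy subrr.
Qed.

Lemma enormE n (x : 'cV[R]_n) : enorm x = Num.sqrt (dot x x).
Proof. by congr Num.sqrt; apply: eq_bigr => i _; rewrite expr2. Qed.

Lemma sqr_enorm n (x : 'cV[R]_n) : enorm x ^+ 2 = dot x x.
Proof. by rewrite enormE sqr_sqrtr ?dotvv_ge0. Qed.

Lemma enorm_ge0 n (x : 'cV[R]_n) : 0 <= enorm x.
Proof. by rewrite enormE sqrtr_ge0. Qed.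

Lemma enorm_eq0 n (x : 'cV[R]_n) : (enorm x == 0) = (x == 0).
Proof. by rewrite -dotvv_eq0 -sqr_enorm sqrf_eq0. Qed.

Lemma enorm0 n : enorm (0 : 'cV[R]_n) = 0.
Proof. by apply/eqP; rewrite enorm_eq0. Qed.

Lemma enorm_gt0 n (x : 'cV[R]_n) : (0 < enorm x) = (x != 0).
Proof. by rewrite lt_def enorm_ge0 enorm_eq0 andbT. Qed.

Lemma enormZ n c (x : 'cV[R]_n) : enorm (c *: x) = `|c| * enorm x.
Proof.
by rewrite !enormE dotZl dotZr mulrA -expr2 sqrtrM ?sqr_ge0// sqrtr_sqr.
Qed.

Lemma enormN n (x : 'cV[R]_n) : enorm (- x) = enorm x.
Proof. by rewrite -scaleN1r enormZ normrN1 mul1r. Qed.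

Lemma enorm_normalized n (x : 'cV[R]_n) :
  x != 0 -> enorm ((enorm x)^-1 *: x) = 1.
Proof.
move=> x0; rewrite enormZ normfV (ger0_norm (enorm_ge0 _)) mulVf//.
by rewrite enorm_eq0.
Qed.

Lemma enorm_coord n (x : 'cV[R]_n) i : `|x i 0| <= enorm x.
Proof.
rewrite -sqrtr_sqr ler_wsqrtr// (bigD1 i) //= lerDl.
by apply: sumr_ge0 => j _; rewrite sqr_ge0.
Qed.

Lemma cauchy_schwarz n (x y : 'cV[R]_n) : dot x y <= enorm x * enorm y.
Proof.
have [->|y0] := eqVneq y 0; first by rewrite dot0r enorm0 mulr0.
rewrite -[leRHS]ger0_norm ?mulr_ge0 ?enorm_ge0//.
apply: (le_trans (ler_norm _)).
rewrite -sqrtr_sqr -[leRHS]sqrtr_sqr ler_wsqrtr// exprMn !sqr_enorm.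
have y2 : 0 < dot y y by rewrite -sqr_enorm exprn_gt0// enorm_gt0.
(* The component of [x] orthogonal to [y], multiplied by [dot y y] to avoid a division. *)
have := dotvv_ge0 (dot y y *: x - dot x y *: y).
rewrite !(dotBl, dotBr, dotZl, dotZr) (dotC y x).
rewrite [X in 0 <= X](_ : _ = dot y y * (dot x x * dot y y - dot x y ^+ 2)).
  by rewrite pmulr_rge0// subr_ge0.
by ring.
Qed.

Lemma cauchy_schwarz_abs n (x y : 'cV[R]_n) : `|dot x y| <= enorm x * enorm y.
Proof.
rewrite ler_norml cauchy_schwarz andbT lerNl -dotNl.
by rewrite (le_trans (cauchy_schwarz _ _))// enormN.
Qed.

(** The squared norm of [x - enorm x *: y] is at most [enorm x ^+ 2] times [1 - 2 + 1]. This
    equality case recovers a control from its pairing with the switching function. *)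
Lemma cauchy_schwarz_eq n (x y : 'cV[R]_n) :
  enorm y <= 1 -> enorm x <= dot x y -> x = enorm x *: y.
Proof.
move=> y1 xy; apply/eqP; rewrite -subr_eq0 -dotvv_eq0 eq_le dotvv_ge0 andbT.
rewrite !(dotBl, dotBr, dotZl, dotZr) (dotC y x) -!sqr_enorm.
have x0 := enorm_ge0 x; have y0 := enorm_ge0 y.
have : enorm y ^+ 2 <= 1 by rewrite expr_le1.
by nra.
Qed.

Lemma ler_enormD n (x y : 'cV[R]_n) : enorm (x + y) <= enorm x + enorm y.
Proof.
rewrite -(@ler_pXn2r _ 2%N)// ?nnegrE ?addr_ge0 ?enorm_ge0//.
rewrite sqr_enorm dotDl !dotDr (dotC y x) sqrrD !sqr_enorm.
have := cauchy_schwarz x y; lra.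
Qed.

Lemma enorm_descent n (x y : 'cV[R]_n) : dot x y < 0 ->
  exists th, 0 < th <= 1 /\ enorm (x + th *: y) < enorm x.
Proof.
set g := dot x y => g0; have D0 := dotvv_ge0 y.
have D1 : 0 < dot y y + 1 by lra.
(* Once [th (|y|^2 + 1) <= - g], the squared norm drops by at least [- th g]. The added 1 keeps the
   denominator positive; the cap 1 makes [th] a weight of a convex combination. *)
pose th := Num.min 1 (- g / (dot y y + 1)).
have th0 : 0 < th by rewrite lt_min ltr01 divr_gt0// oppr_gt0.
have th1 : th <= 1 by rewrite ge_min lexx.
have thD : th * (dot y y + 1) <= - g.
  by rewrite -ler_pdivlMr// ge_min lexx orbT.
exists th; split; first by rewrite th0.
rewrite -(@ltr_pXn2r _ 2%N) ?nnegrE ?enorm_ge0// !sqr_enorm.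
rewrite dotDl !dotDr !dotZl !dotZr (dotC y) -/g.
clearbody th g; nra.
Qed.

(** The hypothesis makes every vector an eigenvector. Coordinate vectors kill the off-diagonal
    entries; [e_i - e_0] and [e_i + e_0] equate the diagonal ones. *)
Lemma scalar_mx_of_ortho n (M : 'M[R]_n) :
  (forall x y : 'cV[R]_n, dot x y = 0 -> dot x (M *m y) = 0) ->
  exists c, M = c%:M.
Proof.
case: n M => [|n] M Mxy; first by exists 0; apply/matrixP => -[].
have Me (i j : 'I_n.+1) (k : 'I_1) : (M *m (delta_mx j k : 'cV_n.+1)) i 0 = M i j.
  by rewrite (ord1 k) -colE mxE.
exists (M 0 0); apply/matrixP => i j; rewrite mxE.
have [<-|ij] := eqVneq i j; last first.
  have := Mxy (delta_mx i 0) (delta_mx j 0).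
  by rewrite !dot_delta Me mxE (negbTE ij); exact.
rewrite mulr1n; apply/eqP; have [->//|i0] := eqVneq i 0.
have := Mxy (delta_mx i 0 - delta_mx 0 0) (delta_mx i 0 + delta_mx 0 0).
have M0 k l : k != l -> M k l = 0.
  move=> kl; have := Mxy (delta_mx k 0) (delta_mx l 0).
  by rewrite !dot_delta Me mxE (negbTE kl); exact.
have i0' : 0 != i by rewrite eq_sym.
rewrite mulmxDr !(dotBl, dotDr, dot_delta) !Me (M0 _ _ i0) (M0 _ _ i0').
rewrite !mxE !eqxx (negbTE i0) (negbTE i0') /= !(addr0, add0r) subrr.
by move=> /(_ erefl)/eqP; rewrite subr_eq0.
Qed.

Lemma scalar_mx_of_quad n (M : 'M[R]_n) c : M^T = M ->
  (forall x : 'cV[R]_n, dot x (M *m x) = c * dot x x) -> M = c%:M.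
Proof.
move=> Ms Mq.
have Mb (x y : 'cV[R]_n) : dot x (M *m y) = c * dot x y.
  have := Mq (x + y); rewrite mulmxDr !(dotDl, dotDr) !Mq.
  rewrite [dot y (M *m x)]dot_mulmxr Ms (dotC _ x) (dotC y x); lra.
have : forall y : 'cV[R]_n, M *m y = c%:M *m y.
  by move=> y; apply: dot_inj => x; rewrite Mb mul_scalar_mx dotZr.
move=> H; apply/matrixP => i j.
have := congr1 (fun v : 'cV_n => v i 0) (H (delta_mx j 0)).
by rewrite -!colE !mxE.
Qed.

End Euclid.

(** * Locally bounded integrands on segments *)

Section IntegralOnSegments.
Context {R : realType}.
Notation mu := (@lebesgue_measure R).
Implicit Types (f g : R -> R) (s t : R).

Definition intg (f : R -> R) (t : R) : R := \int[mu]_(s in `[0, t]) f s.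

(** Unlike integrability, this class is stable under products, as the pairings of controls with
    continuous coefficients require. *)
Definition locbd (f : R -> R) : Prop :=
  measurable_fun (`[0, +oo[ : set R) f /\
  forall T : R, exists M : R, forall s : R, 0 <= s <= T -> `|f s| <= M.

Lemma locbd_integrable f a b : 0 <= a -> locbd f ->
  mu.-integrable `[a, b] (EFin \o f).
Proof.
move=> a0 [mf bf]; apply: measurable_bounded_integrable => //.
- by rewrite /= lebesgue_measure_itv /=; case: ifP => _; rewrite ltry.
- apply: measurable_funS mf => // x /=; rewrite !in_itv /= => /andP[ax _].
  by rewrite (le_trans a0 ax).
- have [M Mf] := bf b; exists M; split; first exact: num_real.
  move=> y My s /=; rewrite in_itv /= => /andP[as_ sb].
  by apply: (le_trans (Mf s _)); [rewrite (le_trans a0)|exact: ltW].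
Qed.

Lemma locbd_cont f : {within (`[0, +oo[ : set R), continuous f} -> locbd f.
Proof.
move=> cf; split; first exact: subspace_continuous_measurable_fun.
move=> T; have cT : {within `[0, T], continuous f}.
  by apply: continuous_subspaceW cf => x /=; rewrite !in_itv /= andbT => /andP[].
have /compact_bounded[M [_ Mf]] := continuous_compact cT (@segment_compact _ _ _).
exists (M + 1) => s s0T; apply: Mf; first by rewrite ltrDl.
by exists s => //=; rewrite in_itv.
Qed.

Lemma locbd_continuous f : continuous f -> locbd f.
Proof. by move=> cf; apply: locbd_cont; exact: continuous_subspaceT. Qed.

Lemma locbd_bounded f M : measurable_fun [set: R] f -> (forall s, `|f s| <= M) ->
  locbd f.
Proof. by move=> mf fM; split; [exact: measurable_funS mf|exists M]. Qed.

Lemma locbd_cst c : locbd (fun=> c).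
Proof. by apply: (@locbd_bounded _ `|c|). Qed.

Lemma locbdD f g : locbd f -> locbd g -> locbd (fun t => f t + g t).
Proof.
move=> [mf bf] [mg bg]; split; first exact: measurable_funD.
move=> T; have [M fM] := bf T; have [N gN] := bg T; exists (M + N) => s sT.
by apply: (le_trans (ler_normD _ _)); apply: lerD; [exact: fM|exact: gN].
Qed.

Lemma locbdM f g : locbd f -> locbd g -> locbd (fun t => f t * g t).
Proof.
move=> [mf bf] [mg bg]; split; first exact: measurable_funM.
move=> T; have [M fM] := bf T; have [N gN] := bg T; exists (M * N) => s sT.
by rewrite normrM ler_pM//; [exact: fM|exact: gN].
Qed.

Lemma locbdN f : locbd f -> locbd (fun t => - f t).
Proof.
move=> lf; rewrite (_ : (fun _ => _) = (fun t => (-1) * f t)).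
  by apply: locbdM => //; exact: locbd_cst.
by apply/funext => t; rewrite mulN1r.
Qed.

Lemma locbdB f g : locbd f -> locbd g -> locbd (fun t => f t - g t).
Proof. by move=> lf lg; apply: locbdD => //; exact: locbdN. Qed.

Lemma locbd_sum (I : Type) (r : seq I) (P : pred I) (f : I -> R -> R) :
  (forall i, locbd (f i)) -> locbd (fun t => \sum_(i <- r | P i) f i t).
Proof.
move=> lf; elim: r => [|i r IH].
  rewrite (_ : (fun _ => _) = (fun=> 0)); first exact: locbd_cst.
  by apply/funext => t; rewrite big_nil.
have [Pi|Pi] := boolP (P i).
- rewrite (_ : (fun _ => _) = (fun t => f i t + \sum_(j <- r | P j) f j t)).
    exact: locbdD.
  by apply/funext => t; rewrite big_cons Pi.
- by under eq_fun do rewrite big_cons (negbTE Pi).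
Qed.

Lemma intg_le0 f t : t <= 0 -> intg f t = 0.
Proof.
rewrite le_eqVlt => /predU1P[->|t0]; rewrite /intg.
  by rewrite set_itv1 Rintegral_set1.
by rewrite set_itv_ge ?Rintegral_set0// bnd_simp -ltNge.
Qed.

Lemma eq_intg f g t : (forall s, 0 <= s <= t -> f s = g s) -> intg f t = intg g t.
Proof.
by move=> fg; apply: eq_Rintegral => s; rewrite inE /= in_itv /=; exact: fg.
Qed.

Lemma intgD f g t : locbd f -> locbd g ->
  intg (fun s => f s + g s) t = intg f t + intg g t.
Proof. by move=> lf lg; apply: RintegralD => //; exact: locbd_integrable. Qed.

Lemma intgZ f c t : locbd f -> intg (fun s => c * f s) t = c * intg f t.
Proof. by move=> lf; apply: RintegralZl => //; exact: locbd_integrable. Qed.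

Lemma intgN f t : locbd f -> intg (fun s => - f s) t = - intg f t.
Proof.
move=> lf; rewrite -mulN1r -intgZ//; apply: eq_intg => s _.
by rewrite mulN1r.
Qed.

Lemma intgB f g t : locbd f -> locbd g ->
  intg (fun s => f s - g s) t = intg f t - intg g t.
Proof. by move=> lf lg; rewrite intgD ?intgN//; exact: locbdN. Qed.

Lemma intg_sum (I : Type) (r : seq I) (f : I -> R -> R) t :
  (forall i, locbd (f i)) ->
  intg (fun s => \sum_(i <- r) f i s) t = \sum_(i <- r) intg (f i) t.
Proof.
move=> lf; elim: r => [|i r IH].
  rewrite big_nil /intg; under eq_Rintegral do rewrite big_nil.
  by rewrite Rintegral_cst// mul0r.
rewrite big_cons -IH -intgD//; last exact: locbd_sum.
by apply: eq_intg => s _; rewrite big_cons.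
Qed.

Lemma ler_intg f g t : locbd f -> locbd g ->
  (forall s, 0 <= s <= t -> f s <= g s) -> intg f t <= intg g t.
Proof.
move=> lf lg fg; by apply: le_Rintegral => //; exact: locbd_integrable.
Qed.

Lemma intg_split f s t : 0 <= s <= t -> locbd f ->
  intg f t - intg f s = \int[mu]_(r in `[s, t]) f r.
Proof.
move=> /andP[s0 st] lf; rewrite /intg Rintegral_itvB.
- rewrite Rintegral_itv_obnd_cbnd//.
  apply: (integrableS _ _ _ (locbd_integrable t s0 lf)) => //.
  exact: subset_itv_oc_cc.
- exact: locbd_integrable.
- by rewrite bnd_simp.
- by rewrite bnd_simp.
Qed.

Lemma measure_segment (s t : R) : s <= t -> fine (mu `[s, t]) = t - s.
Proof.
move=> st; rewrite lebesgue_measure_itv /= lte_fin.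
by case: ltgtP st => // ->; rewrite subrr.
Qed.

Lemma ler_dist_intg f M s t : 0 <= s <= t -> locbd f ->
  (forall r, s <= r <= t -> `|f r| <= M) ->
  `|intg f t - intg f s| <= M * (t - s).
Proof.
move=> /[dup] /andP[s0 st] st' lf fM; rewrite intg_split//.
apply: (le_trans (le_normr_Rintegral _ (locbd_integrable t s0 lf))) => //.
rewrite -measure_segment// -Rintegral_cst//.
have lf' := locbd_integrable t s0 lf.
apply: le_Rintegral => //; first exact: integrable_norm.
exact: (locbd_integrable _ s0 (locbd_cst M)).
Qed.

Lemma ge_intg f m s t : 0 <= s <= t -> locbd f ->
  (forall r, s < r < t -> m <= f r) -> m * (t - s) <= intg f t - intg f s.
Proof.
move=> /[dup] /andP[s0 st] st' lf fM; rewrite intg_split//.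
have lf' := locbd_integrable t s0 lf.
have lm := locbd_integrable t s0 (locbd_cst m).
rewrite -measure_segment// -Rintegral_cst//.
have io g : mu.-integrable `[s, t] (EFin \o g) ->
    \int[mu]_(x in `[s, t]) g x = \int[mu]_(x in `]s, t[) g x.
  move=> ig; have ig1 : mu.-integrable `[s, t[ (EFin \o g).
    apply: integrableS ig => //; exact: subset_itv_co_cc.
  rewrite -Rintegral_itv_bndo_bndc// -Rintegral_itv_obnd_cbnd//.
  by apply: integrableS ig1 => //; exact: subset_itv_oo_co.
rewrite !io//; apply: le_Rintegral => //.
- by apply: integrableS lm => //; exact: subset_itv_oo_cc.
- by apply: integrableS lf' => //; exact: subset_itv_oo_cc.
Qed.

Lemma intg_mono f s t : 0 <= s <= t -> locbd f ->
  (forall r, s <= r <= t -> 0 <= f r) -> intg f s <= intg f t.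
Proof.
move=> st lf f0; rewrite -subr_ge0.
have := @ge_intg f 0 s t st lf; rewrite mul0r; apply=> r /andP[sr rt].
by rewrite f0// !ltW.
Qed.

Lemma intg_eq_except f g c t : locbd f -> locbd g ->
  (forall s, 0 < s <= t -> s != c -> f s = g s) -> intg f t = intg g t.
Proof.
move=> lf lg fg; have [t0|t0] := leP t 0; first by rewrite !intg_le0.
rewrite /intg /Rintegral; congr fine.
have mf h : locbd h -> measurable_fun `[0, t] (EFin \o h).
  by move=> /(locbd_integrable t (lexx 0))/(measurable_int mu).
apply: ae_eq_integral => //; [exact: mf|exact: mf|].
exists ([set 0] `|` [set c]); split => //.
  exact: measurableU.
  by apply: null_set_setU => //; exact: lebesgue_measure_set1.
move=> s /= /not_implyP[]; rewrite in_itv /= => /andP[s0 st] fgs.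
have [->|sc] := eqVneq s c; first by right.
have [->|s0'] := eqVneq s 0; first by left.
by exfalso; apply: fgs; rewrite fg// lt_neqAle eq_sym s0' s0 st.
Qed.

(** Left-continuity at one time is enough: [f] exceeds [f t / 2] on an interval ending at [t]. This
    turns a nonpositive integral of a nonnegative gap into a pointwise equality. *)
Lemma intg_gt0 f t t' : 0 < t <= t' -> locbd f ->
  (forall s, 0 < s < t' -> 0 <= f s) ->
  0 < f t -> f s @[s --> t^'-] --> f t -> 0 < intg f t'.
Proof.
move=> /andP[t0 tt] lf f0 ft cf.
have : \forall s \near t^'-, f t / 2 < f s.
  apply: (cvgr_gt _ cf); lra.
move=> [d /= d0 Hd].
pose s := Num.max (t / 2) (t - d / 2).
have st : s < t by rewrite /s gt_max; apply/andP; split; lra.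
have s0 : 0 < s by rewrite /s lt_max; apply/orP; left; lra.
have ht : f t / 2 * (t - s) <= intg f t - intg f s.
  apply: ge_intg => //; first by rewrite !ltW.
  move=> r /andP[sr rt]; apply/ltW/Hd => //=.
  rewrite gtr0_norm ?subr_gt0//.
  have : t - d / 2 <= s by rewrite /s le_max lexx orbT.
  lra.
have h0 : 0 <= intg f s.
  have := @ge_intg f 0 0 s; rewrite mul0r [intg f 0]intg_le0// subr0; apply=> //.
    by rewrite lexx ltW.
  move=> r /andP[r0 rs]; apply: f0; rewrite r0 (lt_le_trans (lt_trans rs st))//.
have h1 : intg f t <= intg f t'.
  rewrite -subr_ge0; have := @ge_intg f 0 t t'; rewrite mul0r; apply=> //.
    by rewrite (ltW t0) tt.
  by move=> r /andP[r0 rs]; apply: f0; rewrite (lt_trans t0 r0) rs.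
have : 0 < f t / 2 * (t - s) by rewrite mulr_gt0 ?subr_gt0//; lra.
lra.
Qed.

Lemma ler_dist_intg2 f M T s t : locbd f ->
  (forall r, 0 <= r <= T -> `|f r| <= M) -> 0 <= s <= T -> 0 <= t <= T ->
  `|intg f t - intg f s| <= M * `|t - s|.
Proof.
move=> lf fM; wlog st : s t / s <= t.
  move=> H sT tT; have [st|/ltW ts] := leP s t; first exact: H.
  by rewrite distrC [in leRHS]distrC; exact: H.
move=> /andP[s0 sT] /andP[t0 tT].
rewrite [in leRHS]ger0_norm ?subr_ge0//; apply: ler_dist_intg => //.
  by rewrite s0.
by move=> r /andP[sr rt]; rewrite fM// (le_trans s0 sr) (le_trans rt tT).
Qed.

Lemma ler_dist_max0 (s t : R) : `|Num.max 0 s - Num.max 0 t| <= `|s - t|.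
Proof.
case: (leP 0 s) => s0; case: (leP 0 t) => t0 //.
- rewrite !ger0_norm; lra.
- rewrite distrC [leRHS]distrC !ger0_norm; lra.
- by rewrite subrr normr0.
Qed.

Lemma continuous_intg f : locbd f -> continuous (intg f).
Proof.
move=> lf t; have [M fM] := lf.2 (`|t| + 1).
have M0 : 0 <= M.
  by apply: le_trans (fM 0 _); rewrite ?normr_ge0// lexx addr_ge0.
(* [intg] vanishes at negative times, so clipping carries the Lipschitz estimate over from
   nonnegative times to a full neighbourhood of any [t]. *)
have clip s : intg f s = intg f (Num.max 0 s).
  by case: leP => // s0; rewrite !intg_le0// ltW.
have c0 s : s <= `|t| + 1 -> 0 <= Num.max 0 s <= `|t| + 1.
  by move=> st; rewrite le_max lexx ge_max st addr_ge0.
apply/cvgrPdist_le => /= e e0.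
near=> s.
rewrite clip [intg f s]clip.
apply: (le_trans (ler_dist_intg2 lf fM (c0 s _) (c0 t _))).
- rewrite -lerBlDl; apply: (@le_trans _ _ `|s - t|).
    by rewrite (le_trans _ (ler_norm _))// lerB// ler_norm.
  by near: s; apply: cvgr_distC_le => //; exact: cvg_id.
- by rewrite (le_trans (ler_norm _))// lerDl.
- apply: (@le_trans _ _ ((M + 1) * `|t - s|)).
    rewrite ler_pM//; first by rewrite lerDl.
    exact: ler_dist_max0.
  rewrite mulrC -ler_pdivlMr ?ltr_wpDl//.
  near: s; apply: cvgr_dist_le; first exact: cvg_id.
  by rewrite divr_gt0// ltr_wpDl.
Unshelve. all: by end_near. Qed.

Lemma is_derive_intg f t : 0 < t -> locbd f -> {for t, continuous f} ->
  is_derive t 1 (intg f) (f t).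
Proof.
move=> t0 lf cf.
have lt : t < t + 1 by rewrite ltrDl.
have [H1 H2] := continuous_FTC1_closed lt (locbd_integrable _ (lexx 0) lf) t0 cf.
by split; [exact: H1|rewrite -derive1E; exact: H2].
Qed.

Lemma eq_of_quadratic_modulus (D : R -> R) C T : 0 <= T ->
  (forall s t, 0 <= s <= t -> t <= T -> `|D t - D s| <= C * (t - s) ^+ 2) ->
  D T = D 0.
Proof.
move=> T0 DC.
(* Composing with the projection onto [0, T] preserves the modulus and gives a function on the whole
   line whose derivative is zero everywhere, the endpoints included. *)
pose c (t : R) := Num.min T (Num.max 0 t).
have c0T t : 0 <= c t <= T.
  by rewrite /c le_min T0 le_max lexx ge_min lexx.
have cmono s t : s <= t -> 0 <= c t - c s <= t - s.
  by move=> st; rewrite /c; case: (leP 0 t); case: (leP 0 s) => ? ?;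
    do ?[case: (leP T _) => ?]; apply/andP; split; lra.
have C0 : 0 <= C * T ^+ 2.
  by have := DC 0 T; rewrite lexx T0 subr0 lexx => /(_ isT isT); apply: le_trans.
have [T00|Tn0] := eqVneq T 0; first by rewrite T00.
have {}C0 : 0 <= C.
  by rewrite -(@pmulr_lge0 _ (T ^+ 2)) ?exprn_gt0// lt_neqAle eq_sym Tn0.
have H s t : `|D (c t) - D (c s)| <= C * (t - s) ^+ 2.
  wlog st : s t / s <= t.
    move=> H; have [st|/ltW ts] := leP s t; first exact: H.
    by rewrite distrC -sqrrN opprB; exact: H.
  have /andP[h0 h1] := cmono _ _ st; have /andP[cs0 csT] := c0T s.
  have /andP[ct0 ctT] := c0T t.
  apply: (le_trans (DC _ _ _ ctT)); first by rewrite cs0 -subr_ge0.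
  by rewrite ler_wpM2l// ler_pXn2r// nnegrE// subr_ge0.
have -> : T = c T by rewrite /c max_r// minxx.
rewrite -[in RHS](_ : c 0 = 0); last by rewrite /c maxxx min_r.
apply: (@is_derive_0_is_cst _ (D \o c)) => t.
have lim : h^-1 *: ((D \o c) (h *: 1 + t) - (D \o c) t) @[h --> 0^'] --> (0 : R).
  apply/cvgr0Pnorm_le => e e0; near=> h.
  have h0 : h != 0 by near: h; exact: nbhs_dnbhs_neq.
  rewrite /= normrM normfV -[h *: 1]/(h * 1) mulr1.
  rewrite ler_pdivrMl ?normr_gt0//.
  apply: (le_trans (H _ _)); rewrite addrK.
  rewrite -(ger0_norm (sqr_ge0 h)) normrX expr2 mulrCA ler_wpM2l//.
  apply: (@le_trans _ _ ((C + 1) * `|h|)); first by rewrite ler_wpM2r// lerDl.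
  rewrite mulrC -ler_pdivlMr ?ltr_wpDl//.
  by near: h; apply: dnbhs0_le; rewrite divr_gt0// ltr_wpDl.
split; first by apply/cvg_ex; exists 0.
exact: cvg_lim.
Unshelve. all: by end_near. Qed.

(* The two sides differ by a function with quadratic modulus of continuity:
   only boundedness of [f] is needed, no differentiation almost everywhere. *)
Lemma integration_by_parts_locbd (p p' f : R -> R) (c T : R) : 0 <= T ->
  (forall t, is_derive t 1 p (p' t)) -> continuous p' -> locbd f ->
  p T * (c + intg f T) =
  p 0 * c + intg (fun s => p' s * (c + intg f s) + p s * f s) T.
Proof.
move=> T0 dp cp' lf; apply/eqP; rewrite -subr_eq -subr_eq0; apply/eqP.
have cp : continuous p.
  by move=> t; apply/differentiable_continuous/derivable1_diffP; case: (dp t).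
have lp := locbd_continuous cp; have lp' := locbd_continuous cp'.
pose F t := c + intg f t.
have cF : continuous F.
  by move=> t; apply: cvgD; [exact: cvg_cst|exact: continuous_intg].
have lF := locbd_continuous cF.
have lg : locbd (fun s => p' s * F s + p s * f s).
  by apply: locbdD; apply: locbdM.
pose g := fun s => p' s * F s + p s * f s.
pose D t := p t * F t - intg g t.
suff : D T = D 0.
  rewrite [D 0]/D /F (intg_le0 f (lexx 0)) (intg_le0 g (lexx 0)) subr0 addr0.
  by move=> <-; exact: subrr.
have [M1 fM] := lf.2 T; have [M2 pM] := lp'.2 T.
have M10 : 0 <= M1 by apply: le_trans (fM 0 _); rewrite ?normr_ge0// lexx.
have M20 : 0 <= M2 by apply: le_trans (pM 0 _); rewrite ?normr_ge0// lexx.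
apply: (@eq_of_quadratic_modulus _ (M1 * M2 * 2) T T0) => s t /andP[s0 st] tT.
have t0 := le_trans s0 st.
have inT r : s <= r <= t -> 0 <= r <= T.
  by move=> /andP[sr rt]; rewrite (le_trans s0 sr) (le_trans rt tT).
have Flip r : s <= r <= t -> `|F r - F s| <= M1 * (t - s).
  move=> srt; rewrite /F opprD addrACA subrr add0r.
  apply: (le_trans (@ler_dist_intg f M1 s r _ lf _)).
  - by case/andP: srt => -> _; rewrite s0.
  - move=> q /andP[sq qr]; apply/fM/inT; rewrite sq (le_trans qr)//.
    by case/andP: srt.
  - by rewrite ler_wpM2l// lerB//; case/andP: srt.
have plip r : s <= r <= t -> `|p t - p r| <= M2 * (t - s).
  move=> /[dup] srt /andP[sr rt].
  have [|q qrt ->] := @MVT_segment _ p p' r t rt (fun q _ => dp q).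
    exact: continuous_subspaceT.
  rewrite normrM (ger0_norm (_ : 0 <= t - r)) ?subr_ge0//.
  move: qrt; rewrite in_itv /= => /andP[rq qt].
  apply: ler_pM; rewrite ?normr_ge0 ?subr_ge0 ?lerB//.
  by apply/pM/inT; rewrite (le_trans sr rq).
(* Freezing [F] at [s] and [p] at [t] makes each product in the integrand a bounded factor times an
   increment of order [t - s]; the remaining boundary term vanishes by the fundamental theorem of
   calculus. *)
have -> : D t - D s =
    - ((intg (fun r => (p' r * (F r - F s)) - (p t - p r) * f r) t) -
    (intg (fun r => (p' r * (F r - F s)) - (p t - p r) * f r) s))
    + ((p t - p s - (intg p' t - intg p' s)) * F s).
  have E r : intg (fun r => (p' r * (F r - F s)) - (p t - p r) * f r) r =
     intg g r - F s * intg p' r - p t * intg f r.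
    rewrite -intgZ// -intgZ// -!intgB//; last 3 first.
    + by apply: locbdB => //; apply: locbdM => //; exact: locbd_cst.
    + by apply: locbdM => //; exact: locbd_cst.
    + by apply: locbdM => //; exact: locbd_cst.
    by apply: eq_intg => q _; rewrite /g; ring.
  rewrite !E /D.
  have : intg f t = F t - c by rewrite /F addrC addKr.
  have : intg f s = F s - c by rewrite /F addrC addKr.
  by move=> -> ->; ring.
have -> : intg p' t - intg p' s = p t - p s.
  have H r : 0 <= r -> intg p' r = p r - p 0.
    rewrite le_eqVlt => /predU1P[<-|r0]; first by rewrite intg_le0// subrr.
    rewrite /intg /Rintegral (@continuous_FTC2 _ p' p)//.
    - exact: continuous_subspaceT.
    - split; first by move=> q _; case: (dp q).
      + exact: cvg_at_right_filter (cp 0).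
      + exact: cvg_at_left_filter (cp r).
    - by move=> q _; rewrite derive1E; case: (dp q).
  by rewrite !H//; ring.
rewrite subrr mul0r addr0 normrN.
rewrite (_ : M1 * M2 * 2 * (t - s) ^+ 2 =
  (M1 * M2 * 2 * (t - s)) * (t - s)); last by ring.
apply: ler_dist_intg.
- by rewrite s0.
- apply: locbdB; apply: locbdM => //.
    by apply: locbdB => //; exact: locbd_cst.
  by apply: locbdB => //; exact: locbd_cst.
- move=> r srt; apply: (le_trans (ler_normB _ _)); rewrite !normrM.
  rewrite (_ : _ * _ = M2 * (M1 * (t - s)) + M2 * (t - s) * M1); last by ring.
  apply: lerD; apply: ler_pM; rewrite ?normr_ge0//.
  + exact/pM/inT.
  + exact: Flip.
  + exact: plip.
  + exact/fM/inT.
Qed.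

End IntegralOnSegments.

(** * Matrix-valued functions and the exponential *)

Section MatrixCalculus.
Context {R : realType}.

Definition mderiv p q (M : R -> 'M[R]_(p, q)) (D : 'M[R]_(p, q)) (t : R) : Prop :=
  forall i j, is_derive t 1 (fun s => M s i j) (D i j).

Definition mcont p q (M : R -> 'M[R]_(p, q)) : Prop :=
  forall i j, continuous (fun s => M s i j).

Lemma cvg_sumr (I T : Type) (F : set_system T) (r : seq I) (f : I -> T -> R)
    (l : I -> R) : Filter F ->
  (forall i, f i x @[x --> F] --> l i) ->
  (\sum_(i <- r) f i x) @[x --> F] --> \sum_(i <- r) l i.
Proof.
move=> FF fl; elim: r => [|i r IH].
  by under eq_fun do rewrite big_nil; rewrite big_nil; exact: cvg_cst.
under eq_fun do rewrite big_cons; rewrite big_cons.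
exact: cvgD (fl i) IH.
Qed.

Lemma mcontM p q r (M : R -> 'M[R]_(p, q)) (N : R -> 'M[R]_(q, r)) :
  mcont M -> mcont N -> mcont (fun t => M t *m N t).
Proof.
move=> cM cN i j; under eq_fun do rewrite mxE.
move=> t; apply: cvg_sumr => k; exact: cvgM (cM _ _ _) (cN _ _ _).
Qed.

Lemma mcont_cst p q (M : 'M[R]_(p, q)) : mcont (fun=> M).
Proof. by move=> i j t; exact: cvg_cst. Qed.

Lemma mcont_tr p q (M : R -> 'M[R]_(p, q)) : mcont M -> mcont (fun t => (M t)^T).
Proof. by move=> cM i j; under eq_fun do rewrite mxE; exact: cM. Qed.

Lemma mcont_comp p q (M : R -> 'M[R]_(p, q)) (f : R -> R) :
  mcont M -> continuous f -> mcont (fun t => M (f t)).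
Proof.
move=> cM cf i j t.
exact: (@continuous_comp _ _ _ f (fun s => M s i j) _ (cf t) (cM i j _)).
Qed.

Lemma mderiv_cst p q (M : 'M[R]_(p, q)) t : mderiv (fun=> M) 0 t.
Proof. by move=> i j; rewrite mxE; exact: is_derive_cst. Qed.

Lemma mderiv_tr p q (M : R -> 'M[R]_(p, q)) D t :
  mderiv M D t -> mderiv (fun s => (M s)^T) D^T t.
Proof. by move=> dM i j; under eq_fun do rewrite mxE; rewrite mxE; exact: dM. Qed.

Lemma mderivM p q r (M : R -> 'M[R]_(p, q)) (N : R -> 'M[R]_(q, r)) D E t :
  mderiv M D t -> mderiv N E t ->
  mderiv (fun s => M s *m N s) (D *m N t + M t *m E) t.
Proof.
move=> dM dN i j; under eq_fun do rewrite mxE.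
rewrite (_ : (fun _ => _) = \sum_k (fun s => M s i k * N s k j)); last first.
  by apply/funext => s; rewrite fct_sumE.
rewrite !mxE -big_split /=.
apply: is_derive_sum => k; have H := is_deriveM (dM i k) (dN k j).
by apply: (is_derive_eq H); rewrite /GRing.scale /= addrC (mulrC (N _ _ _)).
Qed.

Lemma mderiv_comp_affine p q (M : R -> 'M[R]_(p, q)) D (a b t : R) :
  mderiv M D (a * t + b) -> mderiv (fun s => M (a * s + b)) (a *: D) t.
Proof.
move=> dM i j; rewrite mxE.
have h : is_derive t 1 (fun s : R => a * s + b) a.
  by apply: is_derive_eq; rewrite addr0 /GRing.scale /= mulr1.
have H := @is_derive1_comp R (fun s => M s i j) (fun s : R => a * s + b) t _ _
  (dM i j) h.
by apply: (is_derive_eq H); rewrite mulrC.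
Qed.

Lemma mderiv_cont p q (M : R -> 'M[R]_(p, q)) (D : R -> 'M[R]_(p, q)) :
  (forall t, mderiv M (D t) t) -> mcont M.
Proof.
move=> dM i j t; apply/differentiable_continuous/derivable1_diffP.
by case: (dM t i j).
Qed.

Lemma mderiv0_cst p q (M : R -> 'M[R]_(p, q)) :
  (forall t, mderiv M 0 t) -> forall t, M t = M 0.
Proof.
move=> dM t; apply/matrixP => i j.
apply: (@is_derive_0_is_cst _ (fun s => M s i j)) => s.
by have := dM s i j; rewrite mxE.
Qed.

End MatrixCalculus.
Arguments mcont_cst {R p q} M.

(** * The exponential as an entrywise power series *)

Section MatrixExponential.
Context {R : realType} {n : nat}.
Implicit Types A : 'M[R]_n.

Lemma exp_bounded_pseries_cvg (c : nat -> R) (C K x : R) :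
  (forall k, `|c k| <= K * (C ^+ k / k`!%:R)) -> cvgn (pseries c x).
Proof.
move=> cC; apply: normed_cvg.
apply: (@series_le_cvg R _ (fun k => K * (exp_coeff (C * `|x|)) k)) => [k|k|k|] /=.
- exact: normr_ge0.
- rewrite /exp_coeff /= exprMn mulrAC; apply: le_trans (_ : `|c k| * `|x| ^+ k <= _).
    by rewrite mulr_ge0// exprn_ge0.
  by rewrite mulrA ler_wpM2r ?exprn_ge0.
- rewrite normrM normrX /exp_coeff /= exprMn mulrAC mulrA.
  by rewrite ler_wpM2r ?exprn_ge0.
- exact: is_cvg_seriesZ (is_cvg_series_exp_coeff _).
Qed.

Definition expmx_coeff A i j (k : nat) : R := (A ^+ k) i j / k`!%:R.

(* Each entry is a real power series, so that the termwise differentiation of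
   [pseries] applies. *)
Definition expmx A (t : R) : 'M[R]_n :=
  \matrix_(i, j) limn (pseries (expmx_coeff A i j) t).

Let C A : R := \sum_i \sum_j `|A i j|.

Lemma normr_expr_mx A k i j : `|(A ^+ k) i j| <= C A ^+ k.
Proof.
elim: k i j => [|k IH] i j.
  by rewrite !expr0 mxE; case: eqP => _; rewrite ?normr0 ?normr1.
rewrite !exprS mxE; apply: (le_trans (ler_norm_sum _ _ _)).
apply: (@le_trans _ _ (\sum_l `|A i l| * C A ^+ k)).
  by apply: ler_sum => l _; rewrite normrM ler_wpM2l.
rewrite -mulr_suml ler_wpM2r//.
  by rewrite exprn_ge0//; apply: sumr_ge0 => *; exact: sumr_ge0.
rewrite /C [leRHS](bigD1 i) //= lerDl.
by apply: sumr_ge0 => *; exact: sumr_ge0.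
Qed.

(** The shift [l] makes the family stable under [pseries_diffs], which turns [l] into [l.+1]; one
    estimate then serves the exponential and its derivatives. *)
Lemma cvg_expmx_coeff A i j l (x : R) :
  cvgn (pseries (fun k => (A ^+ (k + l)) i j / k`!%:R) x).
Proof.
apply: (@exp_bounded_pseries_cvg _ (C A) (C A ^+ l)) => k.
rewrite normrM mulrA (ger0_norm (_ : 0 <= k`!%:R^-1)) ?invr_ge0//.
by rewrite ler_wpM2r ?invr_ge0// -exprD addnC normr_expr_mx.
Qed.

Lemma pseries_diffs_expmx A i j l :
  pseries_diffs (fun k => (A ^+ (k + l)) i j / k`!%:R) =
  (fun k => (A ^+ (k + l.+1)) i j / k`!%:R).
Proof.
apply/funext => k; rewrite /pseries_diffs factS natrM addSnnS invfM.
by rewrite mulrCA mulVKf.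
Qed.

Lemma expmx_coeffE A i j :
  expmx_coeff A i j = (fun k => (A ^+ (k + 0)) i j / k`!%:R).
Proof. by apply/funext => k; rewrite addn0. Qed.

Lemma mderiv_expmx_series A t :
  mderiv (expmx A)
    (\matrix_(i, j) limn (pseries (fun k => (A ^+ (k + 1)) i j / k`!%:R) t)) t.
Proof.
move=> i j; rewrite (_ : (fun _ => _) =
    (fun s => limn (pseries (expmx_coeff A i j) s))); last first.
  by apply/funext => s; rewrite mxE.
have := @pseries_snd_diffs R (expmx_coeff A i j) (`|t| + 1) t.
rewrite expmx_coeffE !pseries_diffs_expmx mxE; apply.
- exact: cvg_expmx_coeff.
- exact: cvg_expmx_coeff.
- exact: cvg_expmx_coeff.
- by rewrite [ltRHS]ger0_norm ?addr_ge0// ltrDl.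
Qed.

Lemma mderiv_expmx A t : mderiv (expmx A) (A *m expmx A t) t.
Proof.
move=> i j; apply: (is_derive_eq (mderiv_expmx_series A t i j)).
rewrite mxE; apply/cvg_lim => //.
rewrite (_ : pseries _ t =
  (fun N => \sum_l A i l * pseries (expmx_coeff A l j) t N)); last first.
  apply/funext => N; rewrite /pseries /series /=.
  under [RHS]eq_bigr do rewrite mulr_sumr.
  rewrite exchange_big /=; apply: eq_bigr => k _.
  rewrite addn1 exprS mxE !mulr_suml; apply: eq_bigr => l _.
  by rewrite /expmx_coeff !mulrA.
rewrite mxE; apply: cvg_sumr => l; apply: cvgM; first exact: cvg_cst.
by rewrite mxE expmx_coeffE; exact: cvg_expmx_coeff.
Qed.

Lemma mderiv_expmxr A t : mderiv (expmx A) (expmx A t *m A) t.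
Proof.
move=> i j; apply: (is_derive_eq (mderiv_expmx_series A t i j)).
rewrite mxE; apply/cvg_lim => //.
rewrite (_ : pseries _ t =
  (fun N => \sum_l pseries (expmx_coeff A i l) t N * A l j)); last first.
  apply/funext => N; rewrite /pseries /series /=.
  under [RHS]eq_bigr do rewrite mulr_suml.
  rewrite exchange_big /=; apply: eq_bigr => k _.
  rewrite addn1 exprSr mxE !mulr_suml; apply: eq_bigr => l _.
  by rewrite /expmx_coeff [RHS]mulrC !mulrA (mulrC (A l j)).
rewrite mxE; apply: cvg_sumr => l; apply: cvgM; last exact: cvg_cst.
by rewrite mxE expmx_coeffE; exact: cvg_expmx_coeff.
Qed.

Lemma expmx0 A : expmx A 0 = 1%:M.
Proof.
apply/matrixP => i j; rewrite mxE; apply/cvg_lim => //.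
apply: cvg_near_cst; exists 1%N => // N /= N0.
rewrite /pseries /series /= (big_cat_nat _ (n := 1)) //= big_nat1.
rewrite big_nat_cond big1 ?addr0; last first.
  by move=> k /andP[/andP[k0 _] _]; rewrite expr0n eqn0Ngt k0 mulr0.
by rewrite /expmx_coeff !expr0 fact0 divr1 mulr1.
Qed.

(** Both sides are the derivative of the exponential, read from its series by extracting a factor on
    the left or on the right. *)
Lemma expmx_comm A t : A *m expmx A t = expmx A t *m A.
Proof.
apply/matrixP => i j.
have [_ <-] := mderiv_expmx A t i j; have [_ <-] := mderiv_expmxr A t i j.
by [].
Qed.

Lemma mcont_expmx A : mcont (expmx A).
Proof. exact: mderiv_cont (mderiv_expmx A). Qed.

Lemma mderiv_expmx_sub A (c t : R) :
  mderiv (fun s => expmx A (c - s)) (- (A *m expmx A (c - t))) t.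
Proof.
have := @mderiv_comp_affine R n n (expmx A) (A *m expmx A (-1 * t + c)) (-1) c t.
rewrite scaleN1r mulN1r addrC => H.
rewrite (_ : (fun s => _) = (fun s => expmx A (-1 * s + c))).
  exact/H/mderiv_expmx.
by apply/funext => s; rewrite mulN1r addrC.
Qed.

(** The product of the exponentials at [s + t - r] and at [r] has zero derivative in [r]; compare
    [r = t] with [r = 0]. *)
Lemma expmxD A s t : expmx A (s + t) = expmx A s *m expmx A t.
Proof.
pose M r := expmx A (s + t - r) *m expmx A r.
have dM r : mderiv M 0 r.
  have := mderivM (mderiv_expmx_sub A (s + t) r) (mderiv_expmx A r).
  by rewrite mulNmx (expmx_comm A (s + t - r)) -!mulmxA addNr.
have := mderiv0_cst dM t; rewrite /M subr0 expmx0 mulmx1 addrK.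
by move=> <-.
Qed.

Lemma expmxNK A t : expmx A (- t) *m expmx A t = 1%:M.
Proof. by rewrite -expmxD addNr expmx0. Qed.

Lemma expmxKN A t : expmx A t *m expmx A (- t) = 1%:M.
Proof. by rewrite -expmxD subrr expmx0. Qed.

End MatrixExponential.
Arguments mcont_expmx {R n} A.

(** * Trajectories and duality *)

Section Trajectories.
Context {R : realType}.
Notation mu := (@lebesgue_measure R).

Lemma intg_ae (f g : R -> R) t :
  measurable_fun (`]0, +oo[ : set R) f -> measurable_fun (`]0, +oo[ : set R) g ->
  {ae mu, forall s, 0 < s -> f s = g s} -> intg f t = intg g t.
Proof.
move=> mf mg fg; rewrite /intg /Rintegral; congr fine.
have m0t (h : R -> R) : measurable_fun (`]0, +oo[ : set R) h ->
    measurable_fun `[0, t] (EFin \o h).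
  move=> /measurable_fun_itv_obnd_cbndP mh; apply/measurable_EFinP.
  by apply: measurable_funS mh => // s /=; rewrite !in_itv /= andbT => /andP[].
apply: ae_eq_integral => //; [exact: m0t|exact: m0t|].
case: fg => N [mN N0 fgN]; exists (N `|` [set 0]); split.
- exact: measurableU.
- by apply: null_set_setU => //; exact: lebesgue_measure_set1.
- move=> s /= /not_implyP[]; rewrite in_itv /= => /andP[s0 _] fgs.
  have [->|s0'] := eqVneq s 0; [by right|left].
  by apply: fgN => /= H; apply: fgs; rewrite H// lt_neqAle eq_sym s0'.
Qed.

Lemma cvg_mx T (F : set_system T) p q (M : T -> 'M[R]_(p, q)) (L : 'M[R]_(p, q)) :
  Filter F -> (forall i j, M s i j @[s --> F] --> L i j) -> M s @[s --> F] --> L.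
Proof.
move=> FF ML; apply/cvg_ballP => e e0.
pose P (i : 'I_p) (j : 'I_q) : set T := fun s => ball (L i j) e (M s i j).
have : \forall s \near F, forall i j, P i j s.
  apply: (@filter_forall _ _ (fun i s => forall j, P i j s) F) => i.
  apply: (@filter_forall _ _ (P i) F) => j.
  by have /cvg_ballP/(_ e e0) := ML i j.
by apply: filterS => s Hs; split.
Qed.

Lemma mcont_continuous p q (z : R -> 'M[R]_(p, q)) : mcont z -> continuous z.
Proof. by move=> cz t; apply: cvg_mx => i j; exact: cz. Qed.

Lemma within_coord (D : set R) p q (z : R -> 'M[R]_(p, q)) i j :
  {within D, continuous z} -> {within D, continuous (fun t => z t i j)}.
Proof.
move=> cz t; apply: (@continuous_comp (subspace D) _ _ z
  (fun M : 'M[R]_(p, q) => (M i j : R)) t (cz t)).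
exact: coord_continuous.
Qed.

Definition vintg q (f : R -> 'cV[R]_q) (t : R) : 'cV[R]_q :=
  \col_j intg (fun s => f s j 0) t.

Definition vlocbd p q (M : R -> 'M[R]_(p, q)) := forall i j, locbd (fun s => M s i j).

Lemma vlocbd_mcont p q (M : R -> 'M[R]_(p, q)) : mcont M -> vlocbd M.
Proof. by move=> cM i j; apply: locbd_continuous; exact: cM. Qed.

Lemma vlocbdM p q r (M : R -> 'M[R]_(p, q)) (N : R -> 'M[R]_(q, r)) :
  vlocbd M -> vlocbd N -> vlocbd (fun t => M t *m N t).
Proof.
move=> lM lN i j; under eq_fun do rewrite mxE.
by apply: locbd_sum => k; exact: locbdM.
Qed.

Lemma vlocbdD p q (M N : R -> 'M[R]_(p, q)) :
  vlocbd M -> vlocbd N -> vlocbd (fun t => M t + N t).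
Proof. by move=> lM lN i j; under eq_fun do rewrite mxE; exact: locbdD. Qed.

Lemma vlocbd_cst p q (M : 'M[R]_(p, q)) : vlocbd (fun=> M).
Proof. by move=> i j; exact: locbd_cst. Qed.

Lemma locbd_dot q (f g : R -> 'cV[R]_q) :
  vlocbd f -> vlocbd g -> locbd (fun s => dot (f s) (g s)).
Proof. by move=> lf lg; apply: locbd_sum => k; exact: locbdM. Qed.

Lemma mcont_vintg q (f : R -> 'cV[R]_q) : vlocbd f -> mcont (vintg f).
Proof.
by move=> lf i j; under eq_fun do rewrite mxE; exact: continuous_intg.
Qed.

Lemma mcontD p q (M N : R -> 'M[R]_(p, q)) :
  mcont M -> mcont N -> mcont (fun t => M t + N t).
Proof.
move=> cM cN i j; under eq_fun do rewrite mxE.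
by move=> t; exact: cvgD (cM _ _ _) (cN _ _ _).
Qed.

Lemma dot_vintg q (y : 'cV[R]_q) (f : R -> 'cV[R]_q) t : vlocbd f ->
  dot y (vintg f t) = intg (fun s => dot y (f s)) t.
Proof.
move=> lf; rewrite intg_sum.
  by apply: eq_bigr => i _; rewrite mxE intgZ//; exact: lf.
by move=> i; apply: locbdM; [exact: locbd_cst|exact: lf].
Qed.

Lemma eq_vintg q (f g : R -> 'cV[R]_q) t :
  (forall s, 0 <= s <= t -> f s = g s) -> vintg f t = vintg g t.
Proof.
move=> fg; apply/matrixP => i j; rewrite !mxE.
by apply: eq_intg => s st; rewrite fg.
Qed.

(** With the exponential as [M] it shows that the variation of constants formula solves the
    equation; with the inverse exponential, that every solution is given by that formula. *)
Lemma integration_by_parts_mx p q (M M' : R -> 'M[R]_(p, q)) (f : R -> 'cV[R]_q)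
    (c : 'cV[R]_q) T : 0 <= T ->
  (forall t, mderiv M (M' t) t) -> mcont M' -> vlocbd f ->
  M T *m (c + vintg f T) =
  M 0 *m c + vintg (fun s => M' s *m (c + vintg f s) + M s *m f s) T.
Proof.
move=> T0 dM cM' lf; apply/matrixP => i j; rewrite (ord1 j) !mxE.
have lMf k : locbd (fun s => M' s i k * (c k 0 + intg (fun s => f s k 0) s) +
    M s i k * f s k 0).
  apply: locbdD; apply: locbdM => //.
  - exact/locbd_continuous/cM'.
  - apply: locbdD; first exact: locbd_cst.
    exact/locbd_continuous/continuous_intg/lf.
  - exact/locbd_continuous/(mderiv_cont dM).
transitivity (\sum_k (M 0 i k * c k 0 +
  intg (fun s => M' s i k * (c k 0 + intg (fun s => f s k 0) s) +
                 M s i k * f s k 0) T)).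
  apply: eq_bigr => k _; rewrite !mxE.
  by rewrite (integration_by_parts_locbd _ T0 (fun t => dM t i k)).
rewrite big_split /= -intg_sum//; congr (_ + _).
apply: eq_intg => s _; rewrite !mxE big_split; congr (_ + _).
by apply: eq_bigr => k _; rewrite !mxE.
Qed.

Context {n m : nat} (A : 'M[R]_n) (B : 'M[R]_(n, m)).
Local Notation E := (expmx A).

(* Unlike [admissible], the bound holds everywhere and measurability on the whole
   line; [admissible_nice] shows that nothing is lost. *)
Definition nice (u : R -> 'cV[R]_m) : Prop :=
  (forall i, measurable_fun [set: R] (fun t => u t i 0)) /\
  forall t, enorm (u t) <= 1.

Lemma nice_admissible u : nice u -> admissible u.
Proof.
move=> [mu u1]; split; first by move=> i; exact: measurable_funTS.
by apply: aeW => t _; exact: u1.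
Qed.

Lemma nice_vlocbd u : nice u -> vlocbd u.
Proof.
move=> [mu u1] i j; rewrite (ord1 j); apply: (@locbd_bounded _ _ 1) => // s.
exact: le_trans (enorm_coord _ _) (u1 s).
Qed.

(** Variation of constants, with the exponential factored out so that [E (- t)] cancels it in the
    pairing with a costate. *)
Definition trajectory (x : 'cV[R]_n) (u : R -> 'cV[R]_m) (t : R) : 'cV[R]_n :=
  E t *m (x + vintg (fun s => E (- s) *m B *m u s) t).

Lemma mcont_expmxN : mcont (fun s => E (- s)).
Proof.
apply: mcont_comp; first exact: mcont_expmx.
by move=> t; apply: cvgN; exact: cvg_id.
Qed.

Lemma mcont_expmxNB : mcont (fun s => E (- s) *m B).
Proof. by apply: mcontM; [exact: mcont_expmxN|exact: mcont_cst]. Qed.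

Lemma vlocbd_integrand u : nice u -> vlocbd (fun s => E (- s) *m B *m u s).
Proof.
move=> nu; apply: vlocbdM; last exact: nice_vlocbd.
exact/vlocbd_mcont/mcont_expmxNB.
Qed.

Lemma mcont_trajectory x u : nice u -> mcont (trajectory x u).
Proof.
move=> nu; apply: mcontM; first exact: mcont_expmx.
by apply: mcontD; [exact: mcont_cst|exact/mcont_vintg/vlocbd_integrand].
Qed.

Lemma solution_trajectory x u : nice u -> solution A B x u (trajectory x u).
Proof.
move=> nu; split.
  by apply: continuous_subspaceT; exact/mcont_continuous/mcont_trajectory.
move=> t t0 i.
have := @integration_by_parts_mx n n E (fun t => A *m E t) _ x t t0
  (mderiv_expmx A) (mcontM (mcont_cst A) (mcont_expmx A)) (vlocbd_integrand nu).
rewrite expmx0 mul1mx => /(congr1 (fun v : 'cV_n => v i 0)).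
rewrite /trajectory => ->; rewrite mxE; congr (_ + _); rewrite mxE.
apply: eq_intg => s _; congr ((_ : 'cV_n) i 0).
by rewrite !mulmxA expmxKN mul1mx.
Qed.

Lemma solution_uniq x u z : nice u -> solution A B x u z ->
  forall t, 0 <= t -> z t = trajectory x u t.
Proof.
move=> nu [cz zE] t t0.
have lz : vlocbd z by move=> i j; exact/locbd_cont/within_coord.
have lf : vlocbd (fun s => A *m z s + B *m u s).
  apply: vlocbdD; apply: vlocbdM => //; try exact: vlocbd_cst.
  exact: nice_vlocbd.
have zE' s : 0 <= s -> z s = x + vintg (fun s => A *m z s + B *m u s) s.
  by move=> s0; apply/matrixP => i j; rewrite (ord1 j) zE// !mxE.
have dE s : mderiv (fun s => E (- s)) (- (E (- s) *m A)) s.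
  have := mderiv_expmx_sub A 0 s; rewrite expmx_comm sub0r.
  by under eq_fun do rewrite sub0r.
have := @integration_by_parts_mx n n _ _ _ x t t0 dE _ lf.
rewrite -zE'// oppr0 expmx0 mul1mx => H.
rewrite /trajectory -[LHS]mul1mx -(expmxKN A t) -mulmxA; congr (_ *m _).
rewrite H.
  congr (_ + _); apply: eq_vintg => s /andP[s0 _].
  by rewrite -zE'// mulmxDr mulNmx !mulmxA addKr.
move=> i j; under eq_fun do rewrite mxE.
by move=> s; apply: cvgN; exact: (mcontM mcont_expmxN (mcont_cst A)).
Qed.

Lemma steersE eps x u T : 0 <= T -> nice u ->
  steers A B eps x u T <-> enorm (trajectory x u T) <= eps.
Proof.
move=> T0 nu; split=> [[z [sz]]|]; first by rewrite (solution_uniq nu sz).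
by move=> h; exists (trajectory x u); split => //; exact: solution_trajectory.
Qed.

Lemma trajectory_eq_except x u v c t : nice u -> nice v ->
  (forall s, 0 < s <= t -> s != c -> u s = v s) ->
  trajectory x u t = trajectory x v t.
Proof.
move=> nu nv uv; congr (_ *m (_ + _)); apply/matrixP => i j; rewrite !mxE.
apply: (@intg_eq_except _ _ _ c); try exact: vlocbd_integrand.
by move=> s st sc; rewrite uv.
Qed.

Lemma nice_convex u v th : 0 <= th <= 1 -> nice u -> nice v ->
  nice (fun t => (1 - th) *: u t + th *: v t).
Proof.
move=> /andP[th0 th1] [mu u1] [mv v1]; split=> [i|t].
  under eq_fun do rewrite !mxE.
  by apply: measurable_funD; apply: measurable_funM.
apply: (le_trans (ler_enormD _ _)); rewrite !enormZ !ger0_norm ?subr_ge0//.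
have := u1 t; have := v1 t; nra.
Qed.

Lemma trajectory_convex x u v th t : nice u -> nice v ->
  trajectory x (fun s => (1 - th) *: u s + th *: v s) t =
  (1 - th) *: trajectory x u t + th *: trajectory x v t.
Proof.
move=> nu nv; rewrite /trajectory !scalemxAr -mulmxDr; congr (_ *m _).
rewrite !scalerDr addrACA -scalerDl subrK scale1r; congr (_ + _).
have lu := vlocbd_integrand nu; have lv := vlocbd_integrand nv.
apply: dot_inj => y; rewrite dotDr !dotZr !dot_vintg//; last first.
  have l2 (w : R -> 'cV[R]_m) (a : R) : nice w -> vlocbd (fun s => a *: w s).
    move=> nw i j; under eq_fun do rewrite mxE.
    by apply: locbdM; [exact: locbd_cst|exact: nice_vlocbd].
  apply: vlocbdM; first exact/vlocbd_mcont/mcont_expmxNB.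
  by apply: vlocbdD; exact: l2.
have ld (w : R -> 'cV[R]_n) : vlocbd w -> locbd (fun s => dot y (w s)).
  by move=> lw; apply: locbd_dot => //; exact: vlocbd_cst.
rewrite -!intgZ; [|exact: ld|exact: ld].
rewrite -intgD; try by apply: locbdM; [exact: locbd_cst|exact: ld].
apply: eq_intg => s _; rewrite mulmxDr dotDr -!scalemxAr !dotZr //.
Qed.

Definition switching (zt : 'cV[R]_n) (s : R) : 'cV[R]_m := (E (- s) *m B)^T *m zt.

Lemma mcont_switching zt : mcont (switching zt).
Proof.
by apply: mcontM; [exact/mcont_tr/mcont_expmxNB|exact: mcont_cst].
Qed.

Lemma locbd_dot_switching zt u : nice u ->
  locbd (fun s => dot (switching zt s) (u s)).
Proof.
move=> nu; apply: locbd_dot; last exact: nice_vlocbd.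
exact/vlocbd_mcont/mcont_switching.
Qed.

Lemma dot_trajectory zt x u t : nice u ->
  dot zt (E (- t) *m trajectory x u t) =
  dot zt x + intg (fun s => dot (switching zt s) (u s)) t.
Proof.
move=> nu; rewrite mulmxA expmxNK mul1mx dotDr dot_vintg; last first.
  exact: vlocbd_integrand.
by congr (_ + _); apply: eq_intg => s _; rewrite dot_mulmxr.
Qed.

Lemma admissible_nice u : admissible u -> exists u', nice u' /\
  forall x z, solution A B x u z -> solution A B x u' z.
Proof.
move=> [mu u1].
(* Values of norm above 1, confined to a null set of positive times, and all values at nonpositive
   times become 0. Testing [dot] keeps measurability a matter of sums and products. *)
pose v t := if dot (u t) (u t) <= 1 then u t else 0.
pose w t := if 0 < t then v t else 0.
have mv i : measurable_fun (`]0, +oo[ : set R) (fun t => v t i 0).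
  rewrite (_ : (fun _ => _) =
    (fun t => if dot (u t) (u t) <= 1 then u t i 0 else 0)).
    apply: measurable_fun_if => //.
    - apply: measurable_fun_ler => //; rewrite /dot.
      apply: measurable_sum => j; exact: measurable_funM.
    - by apply: measurable_funS (mu i) => // t [].
  by apply/funext => t; rewrite /v; case: ifP => //; rewrite mxE.
have nw : nice w.
  split=> [i|t].
    rewrite (_ : (fun _ => _) = (fun t => v t i 0) \_ (`]0, +oo[ : set R)).
      by apply/(measurable_restrictT _ _).1 => //; exact: mv.
    apply/funext => t; rewrite /w patchE mem_setE in_itv /= andbT.
    by case: ifP => //; rewrite mxE.
  rewrite /w /v; case: ifP => _; last by rewrite enorm0.
  case: ifP => [u1t|]; last by rewrite enorm0.
  by rewrite enormE -sqrtr1 ler_wsqrtr.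
exists w; split => // x z [cz zE]; split => // t t0 i; rewrite zE//.
congr (_ + _).
have mz j : measurable_fun (`]0, +oo[ : set R) (fun s => z s j 0).
  apply/measurable_fun_itv_obnd_cbndP.
  by have [] : locbd (fun s => z s j 0) by exact/locbd_cont/within_coord.
have mAB (v' : R -> 'cV[R]_m) :
    (forall j, measurable_fun (`]0, +oo[ : set R) (fun s => v' s j 0)) ->
    measurable_fun (`]0, +oo[ : set R) (fun s => (A *m z s + B *m v' s) i 0).
  move=> mv'; rewrite (_ : (fun _ => _) =
    (fun s => \sum_j A i j * z s j 0 + \sum_j B i j * v' s j 0)); last first.
    by apply/funext => s; rewrite !mxE.
  by apply: measurable_funD; apply: measurable_sum => j; apply: measurable_funM.
apply: intg_ae.
- exact: mAB.
- by apply: mAB => j; have := nw.1 j; exact: measurable_funTS.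
- apply: negligibleS u1 => s /= + us; apply => s0; rewrite /w s0 /v.
  by rewrite -sqr_enorm expr_le1// ?us// enorm_ge0.
Qed.

End Trajectories.
Arguments mcont_switching {R n m} A B zt.
Arguments dot_trajectory {R n m} A B zt x [u] t.
Arguments locbd_dot_switching {R n m} A B zt [u].
Arguments mcont_expmxN {R n} A.
Arguments mcont_expmxNB {R n m} A B.

(** * Extremal controls and optimal times *)

Section Limits.
Context {R : realType}.
Notation mu := (@lebesgue_measure R).

Lemma cvg_mx_coord T (F : set_system T) p q (M : T -> 'M[R]_(p, q))
    (L : 'M[R]_(p, q)) i j :
  Filter F -> M s @[s --> F] --> L -> M s i j @[s --> F] --> L i j.
Proof.
move=> FF ML.
exact: (@continuous_cvg _ _ _ F FF M (fun N : 'M[R]_(p, q) => (N i j : R)) L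
  (@coord_continuous _ _ _ i j L) ML).
Qed.

Lemma cvg_dot T (F : set_system T) n (f g : T -> 'cV[R]_n) (a b : 'cV[R]_n) :
  Filter F -> f s @[s --> F] --> a -> g s @[s --> F] --> b ->
  dot (f s) (g s) @[s --> F] --> dot a b.
Proof.
by move=> FF fa gb; apply: cvg_sumr => i; apply: cvgM; exact: cvg_mx_coord.
Qed.

Lemma cvg_enorm T (F : set_system T) n (f : T -> 'cV[R]_n) (a : 'cV[R]_n) :
  Filter F -> f s @[s --> F] --> a -> enorm (f s) @[s --> F] --> enorm a.
Proof.
move=> FF fa; under eq_fun do rewrite enormE; rewrite enormE.
apply: continuous_cvg; first exact: sqrt_continuous.
exact: cvg_dot.
Qed.

Lemma cvg_mulmx T (F : set_system T) p q r (M : T -> 'M[R]_(p, q))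
    (N : T -> 'M[R]_(q, r)) (K : 'M[R]_(p, q)) (L : 'M[R]_(q, r)) :
  Filter F -> M s @[s --> F] --> K -> N s @[s --> F] --> L ->
  (M s *m N s) @[s --> F] --> K *m L.
Proof.
move=> FF MK NL; apply: cvg_mx => i j; rewrite mxE.
under eq_fun do rewrite mxE.
by apply: cvg_sumr => k; apply: cvgM; exact: cvg_mx_coord.
Qed.

Lemma continuous_enorm n (z : R -> 'cV[R]_n) :
  mcont z -> continuous (fun t => enorm (z t)).
Proof. by move=> cz t; apply: cvg_enorm; exact: mcont_continuous. Qed.

Lemma measurable_inv : measurable_fun [set: R] (@GRing.inv R).
Proof.
have -> : [set: R] = [set 0] `|` ~` [set 0] by rewrite setUv.
apply/measurable_funU => //; first exact: measurableC.
split; first exact: measurable_fun_set1.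
apply: open_continuous_measurable_fun.
  by apply/closed_openC/accessible_closed_set1/hausdorff_accessible/norm_hausdorff.
by move=> x; rewrite inE /= => /eqP x0; exact: inv_continuous.
Qed.

(** A violation at [t] would persist on an interval to its left, which has positive measure but lies
    in the exceptional null set. *)
Lemma ae_le_left_lim (f : R -> R) (c t : R) : 0 < t ->
  {ae mu, forall s, 0 < s -> f s <= c} -> f s @[s --> t^'-] --> f t -> f t <= c.
Proof.
move=> t0 [N [mN N0 fN]] ft; rewrite leNgt; apply/negP => ct.
have [d /= d0 Hd] := cvgr_gt _ ft _ ct.
pose a := Num.max 0 (t - d).
have at_ : a < t by rewrite gt_max t0 ltrBlDr ltrDl.
have : (mu `]a, t[ <= mu N)%E.
  apply: le_measure; rewrite ?inE //.
  move=> s /=; rewrite in_itv /= => /andP[as_ st]; apply: fN => /= H.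
  have s0 : 0 < s by apply: le_lt_trans as_; rewrite le_max lexx.
  have : t - d < s by apply: le_lt_trans as_; rewrite le_max lexx orbT.
  move=> tds; have := Hd s; rewrite /= gtr0_norm ?subr_gt0// => /(_ _ st).
  move=> dts; have : c < f s by apply: dts; lra.
  by move: (H s0); rewrite leNgt => /negbTE ->.
rewrite N0 lebesgue_measure_itv /= lte_fin at_ -EFinB lee_fin subr_le0.
by rewrite leNgt at_.
Qed.

End Limits.

Section Extremals.
Context {R : realType} {n m : nat} (A : 'M[R]_n) (B : 'M[R]_(n, m)).
Local Notation E := (expmx A).
Local Notation Q := (switching A B).
Local Notation traj := (trajectory A B).

(* Minimizer of [dot (Q zt t)] over the unit ball; it is [0] where the switching
   function vanishes. *)
Definition bang (zt : 'cV[R]_n) (t : R) : 'cV[R]_m :=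
  - ((enorm (Q zt t))^-1 *: Q zt t).

Lemma nice_bang zt : nice (bang zt).
Proof.
split=> [i|t].
  rewrite (_ : (fun _ => _) = (fun t => (- (enorm (Q zt t))^-1) * Q zt t i 0)).
    apply: measurable_funM; last first.
      exact: continuous_measurable_fun (mcont_switching A B zt i 0).
    apply: measurable_funN; apply: (measurableT_comp measurable_inv).
    exact: continuous_measurable_fun (continuous_enorm (mcont_switching A B zt)).
  by apply/funext => t; rewrite !mxE mulNr.
rewrite /bang enormN; have [->|q0] := eqVneq (Q zt t) 0.
  by rewrite scaler0 enorm0.
by rewrite enorm_normalized.
Qed.

Lemma enorm_bang zt t : Q zt t != 0 -> enorm (bang zt t) = 1.
Proof. by move=> q0; rewrite enormN enorm_normalized. Qed.

Lemma dot_switching_bang zt t : dot (Q zt t) (bang zt t) = - enorm (Q zt t).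
Proof.
rewrite /bang dotNr dotZr -sqr_enorm.
have [->|q0] := eqVneq (enorm (Q zt t)) 0; first by rewrite expr0n mulr0.
by rewrite expr2 mulKf.
Qed.

Lemma dot_switching_ge zt t u : enorm u <= 1 -> - enorm (Q zt t) <= dot (Q zt t) u.
Proof.
move=> u1; have := cauchy_schwarz_abs (Q zt t) u; rewrite ler_norml => /andP[+ _].
by apply: le_trans; rewrite lerN2 ler_piMr// enorm_ge0.
Qed.

Lemma switching_gap_ge0 zt t u :
  enorm u <= 1 -> 0 <= enorm (Q zt t) + dot (Q zt t) u.
Proof. by move=> u1; rewrite -lerBlDl sub0r dot_switching_ge. Qed.

Lemma cvg_switching zt t : Q zt s @[s --> t] --> Q zt t.
Proof. exact: (mcont_continuous (mcont_switching A B zt)). Qed.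

Lemma cvg_bang zt t : Q zt t != 0 -> bang zt s @[s --> t] --> bang zt t.
Proof.
move=> q0; apply: cvgN; apply: cvgZ; last exact: cvg_switching.
by apply: cvgV; [rewrite enorm_eq0|apply: cvg_enorm; exact: cvg_switching].
Qed.

(** The support function, in the direction [zt], of the set of points that can be steered to the
    origin in time [t]: [steers_dual] at radius 0 gives the bound and [dot_start] its attainment. *)
Definition swint zt (t : R) : R := intg (fun s => enorm (Q zt s)) t.

Lemma locbd_enorm_switching zt : locbd (fun s => enorm (Q zt s)).
Proof. exact/locbd_continuous/continuous_enorm/mcont_switching. Qed.

Lemma swint_le zt s t : 0 <= s <= t -> swint zt s <= swint zt t.
Proof.
move=> st; apply: intg_mono => // [|r _]; first exact: locbd_enorm_switching.
exact: enorm_ge0.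
Qed.

Lemma swint_lt zt s t : 0 <= s < t -> Q zt t != 0 -> swint zt s < swint zt t.
Proof.
move=> /andP[s0 st] qt; rewrite -subr_gt0.
have cQ := continuous_enorm (mcont_switching A B zt).
have : \forall r \near t^'-, enorm (Q zt t) / 2 < enorm (Q zt r).
  apply: (@cvgr_gt _ _ _ _ _ (enorm (Q zt t))).
    exact: cvg_at_left_filter (cQ t).
  have : 0 < enorm (Q zt t) by rewrite enorm_gt0.
  lra.
move=> [d /= d0 Hd].
pose a := Num.max s (t - d).
have at_ : a < t by rewrite gt_max st ltrBlDr ltrDl.
have sa : s <= a by rewrite le_max lexx.
have a0 := le_trans s0 sa.
have : 0 < enorm (Q zt t) / 2 * (t - a).
  by rewrite !mulr_gt0 ?subr_gt0 ?enorm_gt0.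
have : enorm (Q zt t) / 2 * (t - a) <= swint zt t - swint zt a.
  apply: ge_intg => //; first by rewrite a0 ltW.
    exact: locbd_enorm_switching.
  move=> r /andP[ar rt]; apply/ltW/Hd => //=.
  have : t - d < r by apply: le_lt_trans ar; rewrite le_max lexx orbT.
  rewrite gtr0_norm ?subr_gt0//; lra.
have : swint zt s <= swint zt a by apply: swint_le; rewrite s0.
lra.
Qed.

Lemma dot_trajectory_bang zt x t :
  dot zt (E (- t) *m traj x (bang zt) t) = dot zt x - swint zt t.
Proof.
rewrite dot_trajectory; last exact: nice_bang.
rewrite -intgN; last exact: locbd_enorm_switching.
by congr (_ + _); apply: eq_intg => s _; rewrite dot_switching_bang.
Qed.

(* Pair the trajectory with the costate [exp(-tA)^T zt]. *)
Lemma steers_dual eps zt x u t : 0 <= t -> admissible u -> steers A B eps x u t ->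
  dot zt x <= eps * enorm ((E (- t))^T *m zt) + swint zt t.
Proof.
move=> t0 /(admissible_nice A B)[v [nv uv]] [z [/uv sz zeps]].
have := dot_trajectory A B zt x t nv; rewrite -(solution_uniq nv sz)// dot_mulmxr.
have := cauchy_schwarz ((E (- t))^T *m zt) (z t).
have : enorm ((E (- t))^T *m zt) * enorm (z t) <= enorm ((E (- t))^T *m zt) * eps.
  by rewrite ler_wpM2l// enorm_ge0.
have : - swint zt t <= intg (fun s => dot (Q zt s) (v s)) t.
  rewrite -intgN; last exact: locbd_enorm_switching.
  apply: ler_intg => [||s _].
  - exact/locbdN/locbd_enorm_switching.
  - exact: locbd_dot_switching.
  - by apply: dot_switching_ge; exact: nv.2.
lra.
Qed.

Lemma opt_time_ge0 eps x : 0 <= opt_time A B eps x.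
Proof.
rewrite /opt_time; set S := [set T | _].
have [->|/set0P S0] := eqVneq S set0; first by rewrite inf0.
by apply: lb_le_inf => // T [/ltW].
Qed.

Lemma opt_time_le eps x u t : 0 < t -> nice u -> enorm (traj x u t) <= eps ->
  opt_time A B eps x <= t.
Proof.
move=> t0 nu zt; apply: ge_inf; first by exists 0 => T [/ltW].
split=> //; exists u; split; first exact: nice_admissible.
by apply/steersE => //; exact: ltW.
Qed.

(** A certificate of optimality: [u] reaches the ball at [T], and the dual bound [steers_dual] fails
    at every earlier time. *)
Lemma opt_timeE eps zt x u T : 0 < T -> nice u ->
  enorm (traj x u T) <= eps ->
  (forall t, 0 < t < T ->
    eps * enorm ((E (- t))^T *m zt) + swint zt t < dot zt x) ->
  opt_time A B eps x = T.
Proof.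
move=> T0 nu zT lbT; apply/eqP; rewrite eq_le (opt_time_le T0 nu zT)/=.
apply: lb_le_inf.
  exists T; split=> //; exists u; split; first exact: nice_admissible.
  by apply/steersE => //; exact: ltW.
move=> t [t0 [v [av sv]]]; rewrite leNgt; apply/negP => tT.
have := steers_dual zt (ltW t0) av sv.
by rewrite leNgt lbT// t0.
Qed.

Lemma opt_repr_nice eps x u : opt_repr A B eps x u -> nice u.
Proof.
move=> [[[mu u1] _] [lc _ _] u0]; split=> [i|t].
  rewrite (_ : (fun t => _) = (fun t => u t i 0) \_ (`]0, +oo[ : set R)).
    by apply/(measurable_restrictT _ _).1 => //; exact: mu.
  apply/funext => t; rewrite patchE mem_setE in_itv /= andbT.
  case: ifPn => // t0; rewrite u0 ?mxE//; apply: contra t0 => /andP[]//.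
have [/andP[t0 tT]|tT] := boolP (0 < t <= opt_time A B eps x); last first.
  by rewrite u0// enorm0.
apply: (ae_le_left_lim (f := fun s => enorm (u s)) t0 u1).
by apply: cvg_enorm; apply: lc; rewrite t0.
Qed.

Lemma opt_repr_trajectory eps x u : opt_repr A B eps x u ->
  enorm (traj x u (opt_time A B eps x)) <= eps.
Proof.
move=> ou; have nu := opt_repr_nice ou; move: ou => [[_ su] _ _].
by apply/steersE => //; exact: opt_time_ge0.
Qed.

(** By Cauchy-Schwarz no endpoint in the ball pairs with the final costate above the value reached
    by [bang zt], yet [bang zt] has the least pairing of all controls. So the gap of [v] has
    integral at most 0 and, [v] being left-continuous, vanishes at each time. *)
Lemma opt_repr_eq_bang eps zt x v : 0 <= eps ->
  let T := opt_time A B eps x in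
  dot zt (E (- T) *m traj x (bang zt) T) = eps * enorm ((E (- T))^T *m zt) ->
  opt_repr A B eps x v ->
  forall t, 0 < t <= T -> Q zt t != 0 -> v t = bang zt t.
Proof.
move=> eps0 T zT ov t tT q0.
have nv := opt_repr_nice ov; have zv := opt_repr_trajectory ov.
have lQ := locbd_enorm_switching zt; have lv := locbd_dot_switching A B zt nv.
have I : intg (fun s => enorm (Q zt s) + dot (Q zt s) (v s)) T <= 0.
  rewrite intgD//.
  have := dot_trajectory A B zt x T nv; rewrite dot_mulmxr.
  move: zT; rewrite dot_trajectory_bang /swint.
  have := cauchy_schwarz ((E (- T))^T *m zt) (traj x v T).
  have : enorm ((E (- T))^T *m zt) * enorm (traj x v T) <=
      enorm ((E (- T))^T *m zt) * eps by rewrite ler_wpM2l// enorm_ge0.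
  lra.
have g0 : enorm (Q zt t) + dot (Q zt t) (v t) <= 0.
  rewrite leNgt; apply/negP => gt0.
  suff : 0 < intg (fun s => enorm (Q zt s) + dot (Q zt s) (v s)) T.
    by rewrite ltNge I.
  apply: (@intg_gt0 _ _ t) => //; first exact: locbdD.
    by move=> s _; exact: switching_gap_ge0 (nv.2 s).
  have Ql : Q zt s @[s --> t^'-] --> Q zt t.
    exact/cvg_at_left_filter/cvg_switching.
  apply: cvgD; first exact: cvg_enorm.
  by apply: cvg_dot => //; case: ov => [_ [lc _ _] _]; exact: lc.
have : - Q zt t = enorm (- Q zt t) *: v t.
  apply: cauchy_schwarz_eq; first exact: nv.2.
  by rewrite enormN dotNl; lra.
rewrite enormN /bang -scalerN => ->.
by rewrite scalerA mulVf ?scale1r// enorm_eq0.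
Qed.

Definition cutoff (T : R) (u : R -> 'cV[R]_m) (t : R) : 'cV[R]_m :=
  if 0 < t <= T then u t else 0.

Lemma nice_cutoff T u : nice u -> nice (cutoff T u).
Proof.
move=> [mu u1]; split=> [i|t]; last first.
  by rewrite /cutoff; case: ifP => // _; rewrite enorm0.
rewrite (_ : (fun t => _) = (fun t => u t i 0) \_ (`]0, T] : set R)).
  apply/(measurable_restrictT _ _).1 => //; exact: measurable_funTS.
apply/funext => t; rewrite patchE mem_setE in_itv /= /cutoff.
by case: ifPn => // t0; rewrite mxE.
Qed.

Lemma opt_repr_cutoff eps x u : nice u ->
  let T := opt_time A B eps x in
  enorm (traj x u T) <= eps -> pw_left_continuous T u ->
  opt_repr A B eps x (cutoff T u).
Proof.
move=> nu T zT [lc rc [D cD]].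
have nc := nice_cutoff T nu.
split; last by move=> t; rewrite /cutoff => /negbTE ->.
- split; first exact: nice_admissible.
  apply/(steersE _ _ _ _ (opt_time_ge0 _ _) nc).
  rewrite (_ : traj _ _ _ = traj x u T)//.
  apply: (@trajectory_eq_except R n m A B x _ _ 0 T nc nu) => s sT _.
  by rewrite /cutoff sT.
- split=> [t tT|t tT|].
  + have -> : cutoff T u t = u t by rewrite /cutoff tT.
    case/andP: (tT) => t0 tT'.
    apply: cvg_trans (lc t tT); apply: near_eq_cvg; near=> s.
    rewrite /cutoff ifT//; apply/andP; split.
      by near: s; exact: nbhs_left_gt.
    apply: le_trans tT'; apply/ltW; near: s; exact: nbhs_left_lt.
  + have [l ul] := rc t tT; exists l; case/andP: tT => t0 tT.
    apply: cvg_trans ul; apply: near_eq_cvg; near=> s.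
    rewrite /cutoff ifT//; apply/andP; split.
      apply: le_lt_trans t0 _; near: s; exact: nbhs_right_gt.
    near: s; exact: nbhs_right_le.
  + exists D => t tT tD.
    have : cutoff T u t = u t by rewrite /cutoff; case/andP: tT => -> /ltW ->.
    rewrite /continuous_at /prop_for => ->.
    apply: cvg_trans (cD t tT tD); case/andP: tT => t0 tT.
    apply: near_eq_cvg; near=> s.
    rewrite /cutoff ifT//; apply/andP; split.
      near: s; exact: lt_nbhsr.
    apply/ltW; near: s; exact: lt_nbhsl.
Unshelve. all: by end_near. Qed.

(** The switching function may vanish at [c], where [bang] is then 0; a left-continuous
    representative must carry the left limit [l] there. *)
Lemma pw_left_continuous_bang zt T c (l l' : 'cV[R]_m) : 0 < T -> 0 < c < T ->
  (forall t, 0 <= t <= T -> t != c -> Q zt t != 0) ->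
  bang zt s @[s --> c^'-] --> l -> bang zt s @[s --> c^'+] --> l' ->
  pw_left_continuous T (fun t => if t == c then l else bang zt t).
Proof.
move=> T0 cT q0 cl cr; set u := fun t => _.
have uE (F : set_system R) (z : 'cV[R]_m) : Filter F ->
    (\forall s \near F, s != c) -> bang zt s @[s --> F] --> z ->
    u s @[s --> F] --> z.
  move=> FF Fc; apply: cvg_trans; apply: near_eq_cvg; near=> s.
  by rewrite /u ifN//; near: s.
have cont t : 0 <= t <= T -> t != c -> u s @[s --> t] --> u t.
  move=> tT tc; rewrite {2}/u (negbTE tc); apply: uE.
    move: tc; rewrite neq_lt => /orP[tc|tc].
      by near=> s; apply/negbT/lt_eqF; near: s; exact: lt_nbhsl.
    by near=> s; apply/negbT/gt_eqF; near: s; exact: lt_nbhsr.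
  by apply: cvg_bang; exact: q0.
split=> [t /andP[t0 tT]|t /andP[t0 tT]|].
- have [->|tc] := eqVneq t c.
    by rewrite {2}/u eqxx; apply: uE => //; exact: nbhs_left_neq.
  by apply/cvg_at_left_filter/cont => //; rewrite ltW.
- have [->|tc] := eqVneq t c.
    by exists l'; apply: uE => //; exact: nbhs_right_neq.
  by exists (u t); apply/cvg_at_right_filter/cont => //; rewrite t0 ltW.
- exists [:: c] => t /andP[t0 tT]; rewrite inE => tc.
  by apply: cont => //; rewrite !ltW.
Unshelve. all: by end_near. Qed.

Lemma nice_switch zt c (l : 'cV[R]_m) : enorm l <= 1 ->
  nice (fun t => if t == c then l else bang zt t).
Proof.
move=> l1; have [mb b1] := nice_bang zt; split=> [i|t]; last by case: ifP.
rewrite (_ : (fun t => _) = (fun t => if t == c then l i 0 else bang zt t i 0)).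
  apply: measurable_fun_ifT => //.
  by apply: measurable_fun_eqr => //; exact: measurable_cst.
by apply/funext => t; case: ifP.
Qed.

(** Exhibiting one representative allows the [xget] to be evaluated; away from [c] its value is then
    identified by [opt_repr_eq_bang]. *)
Lemma opt_control_bang eps zt x c (l l' : 'cV[R]_m) : 0 <= eps ->
  let T := opt_time A B eps x in
  enorm (traj x (bang zt) T) <= eps ->
  dot zt (E (- T) *m traj x (bang zt) T) = eps * enorm ((E (- T))^T *m zt) ->
  0 < c < T -> (forall t, 0 <= t <= T -> t != c -> Q zt t != 0) ->
  enorm l <= 1 ->
  bang zt s @[s --> c^'-] --> l -> bang zt s @[s --> c^'+] --> l' ->
  opt_repr A B eps x (opt_control A B eps x) /\
  forall t, 0 < t <= T -> t != c -> opt_control A B eps x t = bang zt t.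
Proof.
move=> eps0 T zT dT cT q0 l1 cl cr.
have or : opt_repr A B eps x (opt_control A B eps x).
  apply: (@xgetPex _ (fun=> 0) [set u | opt_repr A B eps x u]).
  have nu := nice_switch zt c l1.
  exists (cutoff T (fun t => if t == c then l else bang zt t)).
  apply: (opt_repr_cutoff nu).
    rewrite (@trajectory_eq_except _ _ _ _ _ x _ (bang zt) c)//.
      exact: nice_bang.
    by move=> s _ /negbTE ->.
  by apply: pw_left_continuous_bang cl cr => //; case/andP: cT; exact: lt_trans.
split=> // t tT tc.
apply: (opt_repr_eq_bang eps0 dT or tT).
by apply: q0 => //; case/andP: tT => /ltW -> ->.
Qed.

End Extremals.
Arguments cvg_switching {R n m} A B zt t.

(** * First-order conditions from exact truncation *)

Section TruncationOptimality.
Context {R : realType} {n m : nat} (A : 'M[R]_n) (B : 'M[R]_(n, m)).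
Local Notation E := (expmx A).
Local Notation Q := (switching A B).
Local Notation bang := (bang A B).
Local Notation swint := (swint A B).
Local Notation traj := (trajectory A B).

Lemma switchingZ c zt t : Q (c *: zt) t = c *: Q zt t.
Proof. by rewrite /switching scalemxAr. Qed.

Lemma switchingN zt t : Q (- zt) t = - Q zt t.
Proof. by rewrite /switching mulmxN. Qed.

Lemma switching_tr zt t : Q ((E t)^T *m zt) t = B^T *m zt.
Proof. by rewrite /switching mulmxA -trmx_mul mulmxA expmxKN mul1mx. Qed.

Lemma dot_expmx_tr zt y t : dot ((E t)^T *m zt) (E (- t) *m y) = dot zt y.
Proof. by rewrite dot_mulmxl trmxK mulmxA expmxKN mul1mx. Qed.

(** [zeta] is the initial costate whose value at time [t] is [eta], so the displacement of the
    endpoint along [eta] is an integral of switching gaps. *)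
Lemma dot_trajectory_variation eta x u t : nice u ->
  let zeta := (E t)^T *m eta in
  dot eta (traj x (bang zeta) t - traj x u t) =
  - (swint zeta t + intg (fun s => dot (Q zeta s) (u s)) t).
Proof.
move=> nu zeta; rewrite -(dot_expmx_tr _ _ t) mulmxBr dotBr -/zeta.
by rewrite dot_trajectory_bang (dot_trajectory A B _ _ _ nu); ring.
Qed.

(** The initial point from which [bang zt] arrives at the origin at time [T]. *)
Definition start zt T : 'cV[R]_n := - vintg (fun s => E (- s) *m B *m bang zt s) T.

Lemma trajectory_start zt T : traj (start zt T) (bang zt) T = 0.
Proof. by rewrite /trajectory addNr mulmx0. Qed.

Lemma dot_start zt T : dot zt (start zt T) = swint zt T.
Proof.
have := dot_trajectory_bang A B zt (start zt T) T.
by rewrite trajectory_start mulmx0 dot0r => /esym/eqP; rewrite subr_eq0 => /eqP.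
Qed.

Lemma opt_time_start zt T : 0 < T -> Q zt T != 0 ->
  opt_time A B 0 (start zt T) = T.
Proof.
move=> T0 q0; apply: (@opt_timeE _ _ _ _ _ 0 zt _ (bang zt)) => //.
- exact: nice_bang.
- by rewrite trajectory_start enorm0.
- move=> t /andP[t0 tT]; rewrite mul0r add0r dot_start.
  by apply: swint_lt => //; rewrite ltW.
Qed.

Lemma start_neq0 zt T : 0 < T -> Q zt T != 0 -> start zt T != 0.
Proof.
move=> T0 q0; apply/eqP => s0; have := dot_start zt T.
rewrite s0 dot0r => h; have := @swint_lt _ _ _ A B zt 0 T.
by rewrite lexx T0 -h {1}/swint intg_le0// ltxx => /(_ isT q0).
Qed.

Lemma mderiv_trajectory x (u : R -> 'cV[R]_m) (t : R) : 0 < t -> nice u ->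
  u s @[s --> t] --> u t ->
  mderiv (traj x u) (A *m traj x u t + B *m u t) t.
Proof.
move=> t0 nu cu.
have lf := vlocbd_integrand A B nu.
have dv : mderiv (fun s => x + vintg (fun s => E (- s) *m B *m u s) s)
    (E (- t) *m B *m u t) t.
  move=> i j; rewrite (ord1 j); under eq_fun do rewrite !mxE.
  have cf : {for t, continuous (fun s => (E (- s) *m B *m u s) i 0)}.
    have cE : E (- s) *m B @[s --> t] --> E (- t) *m B.
      exact: (mcont_continuous (mcont_expmxNB A B)).
    have cEu : E (- s) *m B *m u s @[s --> t] --> E (- t) *m B *m u t.
      by apply: cvg_mulmx; [exact: cE|exact: cu].
    by apply: cvg_mx_coord; exact: cEu.
  have := is_deriveD (is_derive_cst (x i 0) t 1) (is_derive_intg t0 (lf i 0) cf).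
  by rewrite add0r.
have := mderivM (mderiv_expmx A t) dv.
by rewrite !mulmxA expmxKN mul1mx.
Qed.

Lemma is_derive_quotient (f : R -> R) (t d : R) : is_derive t 1 f d ->
  (f s - f t) / (s - t) @[s --> t^'] --> d.
Proof.
move=> [df <-]; apply/cvgrPdist_le => e e0.
have := df; rewrite /derivable => /cvg_ex[l fl].
have -> : 'D_1 f t = l by apply/cvg_lim.
move/cvgrPdist_le : fl => /(_ e e0)[r /= r0 H]; exists r => //= s st stt.
have := H (s - t); rewrite /= sub0r normrN distrC => /(_ st).
rewrite subr_eq0 => /(_ stt).
by rewrite -[_ *: 1]/(_ * 1) mulr1 subrK mulrC.
Qed.

Lemma cvg_dnbhs_at_left (V : topologicalType) (f : R -> V) (t : R) (l : V) :
  f s @[s --> t^'] --> l -> f s @[s --> t^'-] --> l.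
Proof.
move=> h P /h [r r0 H]; exists r => // s st stt; apply: H => //.
by rewrite lt_eqF.
Qed.

Lemma cvg_dnbhs_at_right (V : topologicalType) (f : R -> V) (t : R) (l : V) :
  f s @[s --> t^'] --> l -> f s @[s --> t^'+] --> l.
Proof.
move=> h P /h [r r0 H]; exists r => // s st stt; apply: H => //.
by rewrite gt_eqF.
Qed.

Lemma cvg_trajectory_quotient x (u : R -> 'cV[R]_m) (T : R) : 0 < T -> nice u ->
  u s @[s --> T] --> u T -> traj x u T = 0 ->
  (T - s)^-1 *: traj x u s @[s --> T^'-] --> - (B *m u T).
Proof.
move=> T0 nu cu z0; have := mderiv_trajectory x T0 nu cu.
rewrite z0 mulmx0 add0r => dz; apply: cvg_mx => i j.
have := cvg_dnbhs_at_left (is_derive_quotient (dz i j)).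
rewrite z0 [(0 : 'cV_n) i j]mxE => h.
rewrite mxE; under eq_fun do rewrite mxE.
rewrite (_ : (fun s => _) = (fun s => - ((traj x u s i j - 0) / (s - T)))).
  exact: cvgN.
by apply/funext => s; rewrite subr0 -opprB invrN mulNr mulrC.
Qed.

(* [c] is the only possible switching time of [bang zt] on [0, T]; in the absence
   of a switch any interior point will do. *)
Definition one_switch zt T c : Prop :=
  [/\ 0 < c < T, (forall t, 0 <= t <= T -> t != c -> Q zt t != 0)
    & exists l l' : 'cV[R]_m, [/\ enorm l <= 1,
        bang zt s @[s --> c^'-] --> l & bang zt s @[s --> c^'+] --> l']].

Lemma one_switch_end zt T c : one_switch zt T c -> 0 < T /\ Q zt T != 0.
Proof.
move=> [/andP[c0 cT] q0 _]; have T0 := lt_trans c0 cT.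
by split=> //; apply: q0; rewrite ?lexx ?(ltW T0)// gt_eqF.
Qed.

(* The optimal control for a small ball coincides with [bang zt] up to its optimal
   time [tau], and [tau] tends to [T] with the radius by [steers_dual]. Moving from
   [bang zt] towards [bang zeta], where [zeta] is the costate of the ball problem
   ([- z tau] being its inner normal), cannot bring the endpoint inside the ball, so
   both controls minimize the same pairing. *)
Lemma truncation_costate zt T c d : exact_truncation A B -> one_switch zt T c ->
  0 < d -> let z := traj (start zt T) (bang zt) in
  exists tau, [/\ 0 < tau, T - d < tau < T, z tau != 0 &
    forall t, 0 < t <= tau -> t != c ->
    let q := Q ((E tau)^T *m z tau) t in enorm q = - dot q (bang zt t)].
Proof.
move=> htr sw d0 z; have [T0 qT] := one_switch_end sw.
have [cT q0 [l [l' [l1 cl cr]]]] := sw.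
pose x := start zt T; have x0 : x != 0 by exact: start_neq0.
have T0E : opt_time A B 0 x = T by exact: opt_time_start.
have nb := nice_bang A B zt; have cz : mcont z by exact: mcont_trajectory.
have zT : z T = 0 by exact: trajectory_start.
have [epsx [/andP[epsx0 epsxx] tr]] := htr x x0.
pose d' := Num.min d T / 2.
have mdT : 0 < Num.min d T by rewrite lt_min d0.
have d'0 : 0 < d' by rewrite /d'; lra.
have mdd : Num.min d T <= d by rewrite ge_min lexx.
have mdT' : Num.min d T <= T by rewrite ge_min lexx orbT.
have d'd : d' < d by rewrite /d'; lra.
have d'T : d' < T by rewrite /d'; lra.
have cp : continuous (fun t => enorm ((E (- t))^T *m zt)).
  apply: continuous_enorm; apply: mcontM; last exact: mcont_cst.
  exact: mcont_tr (mcont_expmxN A).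
have [M pM] := (locbd_continuous cp).2 T.
have M0 : 0 <= M by apply: le_trans (pM 0 _); rewrite ?normr_ge0// lexx ltW.
pose gap := swint zt T - swint zt (T - d').
have gap0 : 0 < gap by rewrite subr_gt0 swint_lt//; apply/andP; split; lra.
(* [M] bounds the norm of the costate on [0, T]. With [eps * M < gap], reaching the ball before
   [T - d'] would contradict [steers_dual], whose left side is [swint zt T] by [dot_start]. *)
pose eps := Num.min (epsx / 2) (gap / (2 * (M + 1))).
have gM : 0 < gap / (2 * (M + 1)) by rewrite divr_gt0//; lra.
have eps0 : 0 < eps by rewrite /eps lt_min gM andbT; lra.
have epsle : eps <= epsx / 2 by rewrite ge_min lexx.
have epslt : eps < epsx by lra.
have epsM : eps * M < gap.
  have h : eps <= gap / (2 * (M + 1)) by rewrite ge_min lexx orbT.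
  apply: le_lt_trans (ler_wpM2r M0 h) _.
  rewrite mulrAC ltr_pdivrMr; [nra|lra].
pose tau := opt_time A B eps x.
have [s [s0 sT zs]] : exists s, [/\ 0 < s, s < T & enorm (z s) <= eps].
  have : enorm (z s) @[s --> T^'-] --> (0 : R).
    rewrite -(enorm0 n) -zT; apply: cvg_at_left_filter; exact: continuous_enorm.
  move=> /cvgr_le/(_ _ eps0) h.
  near T^'- => s; exists s; split; near: s => //; first exact: nbhs_left_gt.
  exact: nbhs_left_lt.
have tauT : tau < T by apply: le_lt_trans sT; exact: opt_time_le zs.
have tauTd : T - d' <= tau.
  apply: lb_le_inf.
    exists s; split=> //; exists (bang zt); split; first exact: nice_admissible.
    by apply/steersE => //; exact: ltW.
  move=> t [t0 [v [av sv]]]; rewrite leNgt; apply/negP => tTd.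
  have := steers_dual zt (ltW t0) av sv; rewrite dot_start.
  have : swint zt t <= swint zt (T - d') by apply: swint_le; rewrite !ltW.
  have : eps * enorm ((E (- t))^T *m zt) <= eps * M.
    rewrite ler_wpM2l ?(ltW eps0)// (le_trans (ler_norm _))// pM//.
    by rewrite (ltW t0)/=; lra.
  by move: epsM; rewrite /gap; lra.
have tau0 : 0 < tau by lra.
have [_ oc0] : opt_repr A B 0 x (opt_control A B 0 x) /\
    forall t, 0 < t <= T -> t != c -> opt_control A B 0 x t = bang zt t.
  have := @opt_control_bang _ _ _ A B 0 zt x c l l' (lexx 0).
  rewrite /= T0E; apply => //; first by rewrite -/z zT enorm0.
  by rewrite -/z zT mulmx0 dot0r mul0r.
pose v := opt_control A B eps x.
have vb t : 0 < t <= tau -> t != c -> v t = bang zt t.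
  move=> /andP[t0 tt] tc; rewrite /v tr ?eps0// ?t0//.
  by apply: oc0 => //; rewrite t0 (le_trans tt (ltW tauT)).
(* Without a representative [v] would be the default 0, but truncation equates it with [bang zt],
   which has norm one wherever its switching function does not vanish. The sample time has to avoid
   [c]. *)
have ov : opt_repr A B eps x v.
  have [[u ou]|no] := pselect (exists u, opt_repr A B eps x u).
    exact: (@xgetPex _ (fun=> 0) [set u | opt_repr A B eps x u] (ex_intro _ u ou)).
  have v0 : v = fun=> 0.
    by apply: xgetPN => u /= ou; apply: no; exists u.
  have [t [tt tc]] : exists t, 0 < t <= tau /\ t != c.
    have [tc|tc] := eqVneq tau c; last by exists tau; rewrite tau0 lexx.
    exists (tau / 2); split; first by rewrite divr_gt0//= ler_pdivrMr// ler_pMr// ler1n.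
    by rewrite -tc lt_eqF// ltr_pdivrMr// ltr_pMr// ltr1n.
  have := vb _ tt tc; rewrite v0 => /(congr1 (@enorm R m)).
  case/andP: tt => t0 tt.
  rewrite enorm0 enorm_bang; first by move/eqP; rewrite eq_sym oner_eq0.
  by apply: q0 => //; rewrite ltW//= (le_trans tt)// ltW.
have nv := opt_repr_nice ov.
have ztau : enorm (z tau) <= eps.
  have := opt_repr_trajectory ov.
  by rewrite (@trajectory_eq_except _ _ _ A B x v (bang zt) c tau nv nb).
have ztau0 : z tau != 0.
  apply/eqP => h; have := @opt_time_le _ _ _ A B 0 x (bang zt) tau tau0 nb.
  by rewrite -/(z tau) h enorm0 lexx T0E => /(_ isT); rewrite leNgt tauT.
exists tau; split=> //.
  by rewrite tauT andbT (lt_le_trans _ tauTd)// ltrD2l ltrN2.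
pose zeta := (E tau)^T *m z tau; pose w := bang zeta; pose y := traj x w tau.
have nw : nice w by exact: nice_bang.
have hy : 0 <= dot (z tau) (y - z tau).
  rewrite leNgt; apply/negP => /enorm_descent[th [/andP[th0 th1] zth]].
  pose u t := (1 - th) *: bang zt t + th *: w t.
  have nu : nice u by apply: nice_convex => //; rewrite th1 ltW.
  have zu : enorm (traj x u tau) < eps.
    rewrite trajectory_convex// -/(z tau) -/y.
    rewrite (_ : _ + _ = z tau + th *: (y - z tau)).
      exact: lt_le_trans zth ztau.
    by rewrite scalerBr scalerBl scale1r addrA addrAC.
  (* An endpoint strictly inside the ball means, by continuity, that the ball is met before [tau],
     against the minimality of [tau]. *)
  have : enorm (traj x u s) @[s --> tau^'-] --> enorm (traj x u tau).
    by apply: cvg_at_left_filter; apply: continuous_enorm; exact: mcont_trajectory.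
  move=> /cvgr_lt/(_ _ zu) h.
  have [r [r0 rt zr]] : exists r, [/\ 0 < r, r < tau & enorm (traj x u r) <= eps].
    near tau^'- => r; exists r; split.
    - near: r; exact: nbhs_left_gt.
    - near: r; exact: nbhs_left_lt.
    - apply/ltW; near: r; exact: h.
  by have := opt_time_le r0 nu zr; rewrite leNgt -/tau rt.
have I : intg (fun s => enorm (Q zeta s) + dot (Q zeta s) (bang zt s)) tau <= 0.
  rewrite intgD; [|exact: locbd_enorm_switching|exact: locbd_dot_switching].
  by rewrite -oppr_ge0 -(dot_trajectory_variation (z tau) x tau nb).
move=> t /andP[t0 tt] tc; rewrite -/zeta /=.
have qt : Q zt t != 0 by apply: q0 => //; rewrite ltW//= (le_trans tt)// ltW.
apply/eqP; rewrite -subr_eq0 opprK eq_le; apply/andP; split; last first.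
  exact: switching_gap_ge0 (nb.2 t).
rewrite leNgt; apply/negP => gt0.
suff : 0 < intg (fun s => enorm (Q zeta s) + dot (Q zeta s) (bang zt s)) tau.
  by rewrite ltNge I.
apply: (@intg_gt0 _ _ t _ _ _ _ gt0).
- by rewrite t0.
- by apply: locbdD; [exact: locbd_enorm_switching|exact: locbd_dot_switching].
- by move=> r _; exact: switching_gap_ge0 (nb.2 r).
- apply: cvg_at_left_filter; have cq := cvg_switching A B zeta t.
  by apply: cvgD; [exact: cvg_enorm|apply: cvg_dot => //; exact: cvg_bang].
Unshelve. all: by end_near. Qed.

(** The identity of [truncation_costate] is positively homogeneous in the costate, so it survives
    division by [T - tau] and passes to the limit. The limit costate carries a minus sign, which
    reverses the sign of the pairing. *)
Lemma truncation_costate_lim zt T c t : exact_truncation A B ->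
  one_switch zt T c -> 0 < t < T -> t != c ->
  let q := Q ((E T)^T *m (B *m bang zt T)) t in enorm q = dot q (bang zt t).
Proof.
move=> htr sw /andP[t0 tT] tc; have [T0 qT] := one_switch_end sw.
set zt1 := _^T *m _ => q.
pose z := traj (start zt T) (bang zt).
pose phi zeta := enorm (Q zeta t) + dot (Q zeta t) (bang zt t).
have phiZ a zeta : 0 <= a -> phi (a *: zeta) = a * phi zeta.
  by move=> a0; rewrite /phi switchingZ enormZ dotZl ger0_norm// mulrDr.
have cphi : phi ((T - s)^-1 *: ((E s)^T *m z s)) @[s --> T^'-] --> phi (- zt1).
  have h : (T - s)^-1 *: ((E s)^T *m z s) @[s --> T^'-] --> - zt1.
    under eq_fun do rewrite scalemxAr; rewrite /zt1 -mulmxN.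
    apply: cvg_mulmx.
      apply: cvg_at_left_filter.
      exact: (mcont_continuous (mcont_tr (mcont_expmx A))).
    apply: cvg_trajectory_quotient => //; first exact: nice_bang.
      exact: cvg_bang.
    exact: trajectory_start.
  have hQ : Q ((T - s)^-1 *: ((E s)^T *m z s)) t @[s --> T^'-] --> Q (- zt1) t.
    by apply: cvg_mulmx => //; exact: cvg_cst.
  by apply: cvgD; [exact: cvg_enorm|apply: cvg_dot => //; exact: cvg_cst].
have : phi (- zt1) = 0.
  apply/eqP; apply: contrapT => /negP p0.
  (* The identity is known only at some times [tau] accumulating at [T]; a nonzero limit would
     exclude all times close to [T]. *)
  have [d /= d0 Hd] : \forall s \near T^'-,
      phi ((T - s)^-1 *: ((E s)^T *m z s)) != 0.
    exact: cvgr_neq0 cphi p0.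
  have dt0 : 0 < Num.min d (T - t) by rewrite lt_min d0 subr_gt0.
  have [tau [tau0 /andP[taul tauT] z0 H]] := truncation_costate htr sw dt0.
  have hd : Num.min d (T - t) <= d by rewrite ge_min lexx.
  have ht : Num.min d (T - t) <= T - t by rewrite ge_min lexx orbT.
  have := Hd tau; rewrite /= gtr0_norm ?subr_gt0// => /(_ _ tauT).
  rewrite phiZ ?invr_ge0 ?subr_ge0 ?(ltW tauT)// /phi H; [|apply/andP; split; lra|by []].
  by rewrite addNr mulr0 eqxx => /(_ ltac:(lra)).
rewrite /phi switchingN enormN dotNl -/q => /eqP.
by rewrite subr_eq0 => /eqP.
Qed.

(** The limit of [truncation_costate_lim] as [t] tends to [T] beyond the switching time; the control
    is continuous at [T]. *)
Lemma truncation_end zt T c : exact_truncation A B -> one_switch zt T c ->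
  let q := B^T *m (B *m bang zt T) in enorm q = dot q (bang zt T).
Proof.
move=> htr sw q; have [T0 qT] := one_switch_end sw.
pose zt1 := (E T)^T *m (B *m bang zt T).
have qE : q = Q zt1 T by rewrite switching_tr.
pose f t := enorm (Q zt1 t) - dot (Q zt1 t) (bang zt t).
have cf : f t @[t --> T^'-] --> f T.
  apply: cvg_at_left_filter; have cq := cvg_switching A B zt1 T.
  by apply: cvgB; [exact: cvg_enorm|apply: cvg_dot => //; exact: cvg_bang].
have cf0 : f t @[t --> T^'-] --> (0 : R).
  apply: cvg_near_cst; case: (sw) => /andP[c0 cT] _ _; near=> t.
  have ct : c < t by near: t; exact: nbhs_left_gt.
  apply/eqP; rewrite subr_eq0; apply/eqP; apply: truncation_costate_lim sw _ _ => //.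
    rewrite (lt_trans c0 ct)/=; near: t; exact: nbhs_left_lt.
  by rewrite gt_eqF.
have fT : f T = 0 by exact: (cvg_unique _ cf cf0).
by apply/eqP; rewrite -subr_eq0 qE; apply/eqP.
Unshelve. all: by end_near. Qed.

End TruncationOptimality.

(** * Exact truncation forces isotropy *)

Section TruncationIsotropy.
Context {R : realType} {n m : nat} (A : 'M[R]_n) (B : 'M[R]_(n, m)).
Local Notation E := (expmx A).
Local Notation Q := (switching A B).
Local Notation bang := (bang A B).
Local Notation traj := (trajectory A B).

Lemma is_derive_dot p (f g : R -> 'cV[R]_p) (df dg : 'cV[R]_p) (t : R) :
  mderiv f df t -> mderiv g dg t ->
  is_derive t 1 (fun s => dot (f s) (g s)) (dot df (g t) + dot (f t) dg).
Proof.
move=> hf hg; have := mderivM (mderiv_tr hf) hg 0 0.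
under eq_fun do rewrite -dotE.
by rewrite mxE -!dotE.
Qed.

Lemma switching_shift eta T t : Q ((E T)^T *m eta) t = Q eta (t - T).
Proof.
rewrite /switching mulmxA -trmx_mul mulmxA -expmxD.
by congr ((E _ *m _)^T *m _); rewrite opprB addrC.
Qed.

Lemma switching0 eta : Q eta 0 = B^T *m eta.
Proof. by rewrite /switching oppr0 expmx0 mul1mx. Qed.

Lemma mderiv_switching eta t : mderiv (Q eta) (- Q (A^T *m eta) t) t.
Proof.
have dE : mderiv (fun s => E (- s)) (- (A *m E (- t))) t.
  by have := mderiv_expmx_sub A 0 t; under eq_fun do rewrite sub0r; rewrite sub0r.
have := mderivM (mderiv_tr (mderivM dE (mderiv_cst B t))) (mderiv_cst eta t).
rewrite !mulmx0 !addr0 mulNmx -mulmxA linearN mulNmx /=.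
by rewrite /switching !trmx_mul !mulmxA.
Qed.

Lemma one_switch_const zt T : 0 < T ->
  (forall t, 0 <= t <= T -> Q zt t != 0) -> one_switch A B zt T (T / 2).
Proof.
move=> T0 q0; have T2 : 0 < T / 2 < T by apply/andP; split; lra.
have qT2 : Q zt (T / 2) != 0 by apply: q0; case/andP: T2 => /ltW -> /ltW ->.
split=> // [t tT _|]; first exact: q0.
exists (bang zt (T / 2)), (bang zt (T / 2)); split.
- by rewrite enorm_bang.
- exact/cvg_at_left_filter/cvg_bang.
- exact/cvg_at_right_filter/cvg_bang.
Qed.

(** The costate is prescribed at the final time: the switching function on [0, T] is then that of
    [eta] on [- T, 0], close to [B^T *m eta] for small [T]. *)
Lemma switching_neq0_near eta : B^T *m eta != 0 -> exists T, 0 < T /\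
  forall t, 0 <= t <= T -> Q ((E T)^T *m eta) t != 0.
Proof.
rewrite -switching0 -enorm_gt0 => q0.
have : \forall s \near (0 : R), 0 < enorm (Q eta s).
  have h : enorm (Q eta s) @[s --> (0 : R)] --> enorm (Q eta 0).
    by apply: cvg_enorm; exact: cvg_switching.
  exact: cvgr_gt h _ q0.
move=> [r /= r0 H]; exists (r / 2); split; first by rewrite divr_gt0.
move=> t /andP[t0 tr]; rewrite switching_shift -enorm_gt0; apply: H => /=.
rewrite sub0r normrN ltr_norml; apply/andP; split; lra.
Qed.

(* Near a simple zero [c] of the switching function, [bang] has the one-sided
   limits [D / |D|] and [- D / |D|], with [D] the derivative there. *)
Lemma bang_one_sided_limits zt c D : mderiv (Q zt) D c -> Q zt c != 0 \/ D != 0 ->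
  exists l l' : 'cV[R]_m, [/\ enorm l <= 1,
    bang zt s @[s --> c^'-] --> l & bang zt s @[s --> c^'+] --> l'].
Proof.
move=> dQ; have [q0 D0|q0 _] := eqVneq (Q zt c) 0; last first.
  exists (bang zt c), (bang zt c); split.
  - by rewrite enorm_bang.
  - exact/cvg_at_left_filter/cvg_bang.
  - exact/cvg_at_right_filter/cvg_bang.
have {}D0 : D != 0 by case: D0.
have X : (s - c)^-1 *: Q zt s @[s --> c^'] --> D.
  apply: cvg_mx => i j; under eq_fun do rewrite mxE.
  have := is_derive_quotient (dQ i j); rewrite q0 [(0 : 'cV_m) i j]mxE.
  by under eq_fun do rewrite subr0 mulrC.
have N : (enorm ((s - c)^-1 *: Q zt s))^-1 *: ((s - c)^-1 *: Q zt s) @[s --> c^'] -->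
    (enorm D)^-1 *: D.
  apply: cvgZ (X); apply: cvgV; first by rewrite enorm_eq0.
  by apply: cvg_enorm; exact: X.
exists ((enorm D)^-1 *: D), (- ((enorm D)^-1 *: D)); split.
- by rewrite enorm_normalized.
- apply: cvg_trans (cvg_dnbhs_at_left N).
  apply: near_eq_cvg; near=> s.
  have sc : s - c < 0 by rewrite subr_lt0; near: s; exact: nbhs_left_lt.
  rewrite /bang enormZ ltr0_norm ?invr_lt0// invfM scalerA mulrAC.
  by rewrite invrN invrK mulNr mulfV ?lt_eqF// mulN1r scaleNr.
- apply: cvg_trans (cvg_dnbhs_at_right (cvgN N)).
  apply: near_eq_cvg; near=> s.
  have sc : 0 < s - c by rewrite subr_gt0; near: s; exact: nbhs_right_gt.
  rewrite /bang enormZ gtr0_norm ?invr_gt0// invfM scalerA mulrAC.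
  by rewrite invrK mulfV ?gt_eqF// mul1r.
Unshelve. all: by end_near. Qed.

(** With terminal costate [eta] the last control value points against [B^T *m eta]; [truncation_end]
    and equality in Cauchy-Schwarz make it an eigenvector of [B^T *m B]. *)
Lemma truncation_eigen (eta : 'cV[R]_n) : exact_truncation A B -> exists k,
  B^T *m (B *m (B^T *m eta)) = k *: (B^T *m eta).
Proof.
move=> htr; have [->|be] := eqVneq (B^T *m eta) 0.
  by exists 0; rewrite !mulmx0 scaler0.
have [T [T0 q0]] := switching_neq0_near be.
set zt := (E T)^T *m eta in q0.
have sw := one_switch_const T0 q0.
have QT : Q zt T = B^T *m eta by rewrite /zt switching_tr.
have := truncation_end htr sw; rewrite /= => /eqP; rewrite eq_le => /andP[h _].
have := cauchy_schwarz_eq ((nice_bang A B zt).2 T) h.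
set k := enorm _; rewrite /bang QT !mulmxN !scalerN => /oppr_inj.
have ne : (enorm (B^T *m eta))^-1 != 0 by rewrite invr_eq0 enorm_eq0.
rewrite -!scalemxAr scalerA mulrC -scalerA => /(scalerI ne) ->.
by exists k.
Qed.

(** If the kernel of [B^T] is stable under [A^T], it is orthogonal to all columns of the Kalman
    matrix, which span the space. *)
Lemma ker_kalman : \rank (kalman A B) = n ->
  (forall eta : 'cV[R]_n, B^T *m eta = 0 -> B^T *m (A^T *m eta) = 0) ->
  forall eta : 'cV[R]_n, B^T *m eta = 0 -> eta = 0.
Proof.
move=> rk h eta be0.
have hk k : B^T *m ((A ^+ k)^T *m eta) = 0.
  elim: k eta be0 => [|k IH] eta be0; first by rewrite expr0 trmx1 mul1mx.
  rewrite exprS -[_ * _]/(A *m A ^+ k) trmx_mul -mulmxA; apply: IH.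
  exact: h.
apply: trmx_inj; rewrite linear0.
have rf : row_free (kalman A B) by rewrite /row_free rk.
apply/eqP; rewrite -(mulmx_free_eq0 _ rf) /kalman mul_mxrow; apply/eqP.
rewrite -[RHS]mxrow0; apply: eq_mxrow => j.
by apply: trmx_inj; rewrite !trmx_mul trmxK -mulmxA hk linear0.
Qed.

(* If [q0 = B^T A^T eta] were nonzero, then for small [d > 0] the extremal with
   terminal costate [eta - d A^T eta] would switch close to its end: its switching
   function is [- d q0] at the end and close to a positive multiple of [q0] somewhat
   earlier. The costate of the ball problem is near [B q0] there and has no switch. *)
Lemma truncation_ker_step (eta : 'cV[R]_n) : exact_truncation A B -> B^T *m eta = 0 ->
  B^T *m (A^T *m eta) = 0.
Proof.
move=> htr be0; apply/eqP; apply: contrapT => /negP.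
set q0 := B^T *m _ => q00.
have q2 : 0 < dot q0 q0 by rewrite lt_def dotvv_eq0 q00 dotvv_ge0.
pose f s := dot (Q (A^T *m eta) s) q0.
pose g s := dot (Q (A^T *m (A^T *m eta)) s) q0.
pose h s := dot (Q (B *m q0) s) q0.
have cdot zt : continuous (fun s => dot (Q zt s) q0).
  by move=> s; apply: cvg_dot; [exact: cvg_switching|exact: cvg_cst].
have f0 : f 0 = dot q0 q0 by rewrite /f switching0.
have h0 : 0 < h 0.
  rewrite /h switching0 dot_mulmxl trmxK lt_def dotvv_ge0 andbT dotvv_eq0.
  (* [dot q0 q0] is the pairing of [A^T *m eta] with [B *m q0]. *)
  apply: contra q00 => /eqP Bq0.
  by rewrite -dotvv_eq0 {1}/q0 dot_mulmxl trmxK Bq0 dot0r.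
have [T [T0 fT hT]] : exists T, [/\ 0 < T,
    forall s, - T <= s <= 0 -> dot q0 q0 / 2 <= f s &
    forall s, - T <= s <= 0 -> 0 < h s].
  have : \forall s \near (0 : R), dot q0 q0 / 2 <= f s /\ 0 < h s.
    near=> s; split; near: s.
    - apply: (cvgr_ge _ (cdot _ 0)); rewrite -/(f 0) f0.
      by rewrite ltr_pdivrMr// ltr_pMr// ltr1n.
    - exact: (cvgr_gt _ (cdot _ 0)).
  move=> [r /= r0 H]; exists (r / 2); rewrite divr_gt0//.
  have ball s : - (r / 2) <= s <= 0 -> ball_ Num.norm 0 r s.
    by clear -r0 => /= ?; rewrite sub0r normrN ltr_norml; lra.
  by split=> // s /ball/H[].
have [K gK] : exists K, forall s, - T <= s <= 0 -> g s <= K.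
  have T00 : - T <= 0 by rewrite oppr_le0 ltW.
  have [c _ gc] := EVT_max T00 (continuous_subspaceT (cdot (A^T *m (A^T *m eta)))).
  by exists (g c) => s sT; apply: gc; rewrite in_itv.
pose K1 : R := `|K| + 1.
have K10 : 0 < K1 by rewrite ltr_wpDl.
(* The first bound keeps the slope of [psi] at most [- |q0|^2 / 4]; the second keeps its end value
   [- d |q0|^2] small against the variation over a length [T], so that [psi] is positive at
   [- T]. *)
pose d := Num.min (dot q0 q0 / (4 * K1)) (T / 8).
have d0 : 0 < d by rewrite lt_min !divr_gt0// mulr_gt0.
have dK : d * K1 <= dot q0 q0 / 4.
  rewrite -ler_pdivlMr// -mulrA -invfM; rewrite ge_min; apply/orP; left.
  by rewrite lexx.
have dT : d <= T / 8 by rewrite ge_min lexx orbT.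
pose eta' : 'cV[R]_n := eta - d *: (A^T *m eta).
(* One scalar component of the switching function: strictly decreasing on [- T, 0], it leaves at
   most one time at which the whole function can vanish. *)
pose psi s := dot (Q eta' s) q0.
have psi' (s : R) : is_derive s (1 : R) psi (- (f s - d * g s)).
  have := is_derive_dot (mderiv_switching eta' s) (mderiv_cst q0 s).
  move=> H; apply: (is_derive_eq H); rewrite dot0r addr0 dotNl.
  rewrite /eta' mulmxBr -scalemxAr /switching mulmxBr -scalemxAr.
  by rewrite dotBl dotZl.
have psi'lt s : - T <= s <= 0 -> - (f s - d * g s) <= - (dot q0 q0 / 4).
  move=> sT; rewrite lerN2.
  have h1 : d * g s <= d * K1.
    apply: ler_wpM2l; first exact: ltW.
    by apply: (le_trans (gK s sT)); apply: (le_trans (ler_norm _)); rewrite lerDl.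
  have h2 := fT s sT.
  apply: (@le_trans _ _ (dot q0 q0 / 2 - dot q0 q0 / 4)).
    by clear; lra.
  by apply: lerB => //; exact: le_trans h1 dK.
have cpsi : continuous psi by exact: cdot.
have psi_dec s t : - T <= s -> s < t -> t <= 0 ->
    psi t + (dot q0 q0 / 4) * (t - s) <= psi s.
  move=> Ts st t0.
  have [r] := MVT st (fun s _ => psi' s) (continuous_subspaceT cpsi).
  rewrite in_itv /= => /andP[sr rt] e.
  have : psi t - psi s <= - (dot q0 q0 / 4) * (t - s).
    rewrite e; apply: ler_wpM2r; first by rewrite subr_ge0 ltW.
    by apply: psi'lt; rewrite (le_trans Ts (ltW sr)) (le_trans (ltW rt) t0).
  by clear; lra.
have psi0 : psi 0 = - d * dot q0 q0.
  rewrite /psi switching0 /eta' mulmxBr be0 sub0r -scalemxAr -/q0.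
  by rewrite dotNl dotZl mulNr.
have psiT : 0 < psi (- T).
  have := psi_dec (- T) 0 (lexx _); rewrite oppr_lt0 => /(_ T0 (lexx _)).
  rewrite psi0 sub0r opprK; apply: lt_le_trans.
  by clear -dT T0 q2 d0; nra.
have psi0lt : psi 0 < 0 by rewrite psi0 mulNr oppr_lt0 mulr_gt0.
have [c cT psic] : exists2 c, c \in `[- T, 0] & psi c = 0.
  apply: IVT; first by rewrite oppr_le0 ltW.
    exact: continuous_subspaceT.
  by rewrite ge_min le_max (ltW psi0lt) (ltW psiT) orbT.
move: cT; rewrite in_itv /= => /andP[Tc c0].
have {}Tc : - T < c.
  by rewrite lt_neqAle Tc andbT; apply/eqP => cT; move: psiT; rewrite cT psic ltxx.
have {}c0 : c < 0.
  by rewrite lt_neqAle c0 andbT; apply/eqP => c0'; move: psic psi0lt;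
    rewrite c0' => ->; rewrite ltxx.
have psi_ne s : - T <= s <= 0 -> s != c -> psi s != 0.
  move=> /andP[Ts s0]; rewrite neq_lt => /orP[sc|cs].
  - have := psi_dec s c Ts sc (ltW c0); rewrite psic add0r => h1.
    rewrite gt_eqF//; apply: lt_le_trans h1.
    by rewrite mulr_gt0 ?subr_gt0// divr_gt0.
  - have := psi_dec c s (ltW Tc) cs s0; rewrite psic => h1.
    rewrite lt_eqF//; apply: lt_le_trans h1.
    by rewrite ltrDl mulr_gt0 ?subr_gt0// divr_gt0.
pose zt := (E T)^T *m eta'.
have Qzt t : Q zt t = Q eta' (t - T) by exact: switching_shift.
have sw : one_switch A B zt T (c + T).
  split.
  - by apply/andP; split; [rewrite -ltrBlDr sub0r|rewrite gtrDr].
  - move=> t /andP[t0 tT] tc; rewrite Qzt; apply/eqP => Q0.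
    have h1 : - T <= t - T <= 0 by rewrite lerBrDr addNr t0 subr_le0.
    have h2 : t - T != c by rewrite subr_eq.
    by have := psi_ne _ h1 h2; rewrite /psi Q0 dot0l eqxx.
  - apply: (@bang_one_sided_limits _ _ (- Q (A^T *m eta') c)).
      rewrite (_ : Q zt = fun t => Q eta' (1 * t - T)); last first.
        by apply/funext => t; rewrite mul1r.
      rewrite -[X in mderiv _ X]scale1r.
      apply: (@mderiv_comp_affine R m 1 (Q eta') _ 1 (- T)).
      rewrite mul1r addrK; exact: mderiv_switching.
    right; apply/eqP => D0.
    have cc : - T <= c <= 0 by rewrite (ltW Tc) (ltW c0).
    have := psi'lt c cc; rewrite leNgt => /negP; apply.
    suff -> : - (f c - d * g c) = 0 by rewrite oppr_lt0 divr_gt0.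
    have [_ e1] := psi' c.
    have [_ e2] := is_derive_dot (mderiv_switching eta' c) (mderiv_cst q0 c).
    by rewrite (etrans (esym e1) e2) D0 dot0l dot0r addr0.
have cT0 : 0 < c + T by rewrite -ltrBlDr sub0r.
have [t0 tT] : 0 < (c + T) / 2 /\ (c + T) / 2 < c + T.
  by clear -cT0; split; lra.
have tT' : 0 < (c + T) / 2 < T.
  by rewrite t0 (lt_trans tT)// gtrDr.
have tc : (c + T) / 2 != c + T by rewrite lt_eqF.
have := truncation_costate_lim htr sw tT' tc.
set b := bang zt T; set t := (c + T) / 2 => /= key.
have Qt0 : Q zt t != 0.
  by case: sw => _ + _; apply => //; rewrite !ltW//; case/andP: tT'.
have tT1 : - T <= t - T by rewrite lerBrDr addNr ltW.
have tT2 : t - T < c by rewrite ltrBlDr.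
(* By [key] this switching vector is a nonnegative multiple of [bang zt t], which before the switch
   points against [q0]. The terminal control [b] points along [q0], so positivity of [h] gives the
   opposite sign. *)
have : dot (Q ((E T)^T *m (B *m b)) t) q0 <= 0.
  have kle : enorm (Q ((E T)^T *m (B *m b)) t) <=
    dot (Q ((E T)^T *m (B *m b)) t) (bang zt t) by rewrite key.
  rewrite (cauchy_schwarz_eq ((nice_bang A B zt).2 t) kle) dotZl.
  apply: mulr_ge0_le0; first exact: enorm_ge0.
  rewrite /bang dotNl dotZl oppr_le0; apply: mulr_ge0.
    by rewrite invr_ge0 enorm_ge0.
  rewrite Qzt; have := psi_dec (t - T) c tT1 tT2 (ltW c0); rewrite psic add0r.
  apply: le_trans; apply: mulr_ge0; first by rewrite divr_ge0// ltW.
  by rewrite subr_ge0 ltW.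
rewrite switching_shift => hle.
have bE : b = (enorm q0)^-1 *: q0.
  rewrite /b /bang Qzt subrr switching0 /eta' mulmxBr be0 sub0r -scalemxAr -/q0.
  rewrite enormN enormZ gtr0_norm// scalerN opprK scalerA.
  by rewrite invfM mulrAC mulVf ?mul1r// gt_eqF.
have : 0 < dot (Q (B *m b) (t - T)) q0.
  rewrite bE -scalemxAr switchingZ dotZl mulr_gt0 ?invr_gt0 ?enorm_gt0//.
  by apply: hT; rewrite tT1 (le_trans (ltW tT2) (ltW c0)).
by rewrite ltNge hle.
Unshelve. all: by end_near. Qed.

Lemma truncation_BBt : (0 < n)%N -> \rank (kalman A B) = n ->
  exact_truncation A B -> exists beta, 0 < beta /\ B *m B^T = beta%:M.
Proof.
move=> n0 rk htr.
have inj := ker_kalman rk (fun eta => truncation_ker_step htr).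
have [beta hbeta] : exists beta, B *m B^T = beta%:M.
  apply: scalar_mx_of_ortho => x y xy.
  have [k hk] := truncation_eigen y htr.
  (* Injectivity of [B^T] lifts the eigenvector relation from [B^T *m y] to [y]. *)
  have : B *m (B^T *m y) - k *: y = 0.
    by apply: inj; rewrite mulmxBr -scalemxAr hk subrr.
  move/eqP; rewrite subr_eq0 mulmxA => /eqP ->.
  by rewrite dotZr xy mulr0.
exists beta; split=> //.
pose e : 'cV[R]_n := delta_mx (Ordinal n0) 0.
have e0 : B^T *m e != 0.
  apply/eqP => /inj/(congr1 (fun v : 'cV_n => v (Ordinal n0) 0)).
  by rewrite !mxE !eqxx => /eqP; rewrite oner_eq0.
have : 0 < dot (B^T *m e) (B^T *m e) by rewrite lt_def dotvv_eq0 e0 dotvv_ge0.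
by rewrite dot_mulmxl trmxK mulmxA hbeta mul_scalar_mx dotZr dot_delta mxE !eqxx mulr1.
Qed.

(* At the times [tau] of [truncation_costate] the state is parallel to the costate,
   hence orthogonal to [W]; apply Rolle's theorem to [dot z W] between [tau] and [T]
   and divide by the distance to [T]. *)
Lemma truncation_skew beta : exact_truncation A B -> 0 < beta ->
  B *m B^T = beta%:M -> forall eta w : 'cV[R]_n, dot eta w = 0 ->
  dot eta ((A + A^T) *m w) = 0.
Proof.
move=> htr beta0 BB eta w ew.
have BBv (v : 'cV[R]_n) : B *m (B^T *m v) = beta *: v.
  by rewrite mulmxA BB mul_scalar_mx.
have [->|eta0] := eqVneq eta 0; first by rewrite dot0l.
have be : B^T *m eta != 0.
  apply: contra eta0 => /eqP h; have := BBv eta; rewrite h mulmx0 => /esym/eqP.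
  by rewrite scaler_eq0 gt_eqF.
have [T [T0 q0]] := switching_neq0_near be.
set zt := (E T)^T *m eta in q0.
have sw := one_switch_const T0 q0.
have nb := nice_bang A B zt.
pose z := traj (start A B zt T) (bang zt).
have zT : z T = 0 by exact: trajectory_start.
(* A free motion with final value [w]; its pairing with the costate is constant, equal to
   [dot eta w], that is 0. *)
pose W t := E (t - T) *m w.
have dW t : mderiv W (A *m W t) t.
  rewrite (_ : W = fun t => E (1 * t - T) *m w); last first.
    by apply/funext => s; rewrite /W mul1r.
  have dE := @mderiv_comp_affine R n n E _ 1 (- T) t (mderiv_expmx A _).
  by have := mderivM dE (mderiv_cst w t); rewrite mulmx0 addr0 scale1r mul1r mulmxA.
have cW : mcont W by exact: mderiv_cont dW.
have QE t : Q zt t = B^T *m ((E (T - t))^T *m eta).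
  by rewrite /zt switching_shift /switching opprB trmx_mul mulmxA.
have Bb t : B *m bang zt t = - ((enorm (Q zt t))^-1 * beta) *: ((E (T - t))^T *m eta).
  by rewrite /bang mulmxN -scalemxAr {2}QE BBv scalerA scaleNr.
have ortho t : dot ((E (T - t))^T *m eta) (W t) = 0.
  by rewrite dot_mulmxl trmxK /W -(opprB t T) mulmxA expmxNK mul1mx.
apply/eqP; apply: contrapT => /negP D0; set S := A + A^T in D0.
have lim : dot ((T - s)^-1 *: z s) (S *m W s) @[s --> T^'-] -->
    dot (- (B *m bang zt T)) (S *m W T).
  apply: cvg_dot.
    apply: cvg_trajectory_quotient => //.
    by apply: cvg_bang; apply: q0; rewrite ltW//= lexx.
  apply: cvg_at_left_filter; apply: cvg_mulmx; first exact: cvg_cst.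
  exact: (mcont_continuous cW).
have lim0 : dot (- (B *m bang zt T)) (S *m W T) != 0.
  have -> : W T = w by rewrite /W subrr expmx0 mul1mx.
  rewrite Bb subrr expmx0 trmx1 mul1mx scaleNr opprK dotZl mulf_neq0//.
  by rewrite mulf_neq0 ?invr_eq0 ?enorm_eq0 ?gt_eqF// q0// lexx ltW.
have [d /= d0 Hd] := cvgr_neq0 _ lim lim0.
have d10 : 0 < Num.min d (T / 2) by rewrite lt_min d0 divr_gt0.
have [tau [tau0 /andP[taul tauT] _ H]] := truncation_costate htr sw d10.
have tauT2 : T / 2 < tau.
  apply: le_lt_trans taul; rewrite lerBrDr [leRHS](splitr T) lerD2l.
  by rewrite ge_min lexx orbT.
have taud : T - d < tau.
  by apply: le_lt_trans taul; rewrite lerD2l lerN2 ge_min lexx.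
have [k ztau] : exists k, z tau = k *: ((E (T - tau))^T *m eta).
  have := H tau; rewrite tau0 lexx gt_eqF// => /(_ isT isT) /=.
  rewrite switching_tr -/z; set q := B^T *m z tau => hq.
  have hq' : enorm (- q) <= dot (- q) (bang zt tau) by rewrite enormN dotNl hq.
  have := cauchy_schwarz_eq (nb.2 tau) hq'.
  (* As [B *m B^T] is scalar, applying [B] recovers the state and the costate from their images
     under [B^T]. *)
  move=> /(congr1 (mulmx B)); rewrite mulmxN BBv -scalemxAr Bb scalerA => h.
  exists (- beta^-1 * (enorm (- q) * - ((enorm (Q zt tau))^-1 * beta))).
  by rewrite -[RHS]scalerA -h scalerN scalerA mulNr scaleNr opprK mulVf ?scale1r ?gt_eqF.
pose phi t := dot (z t) (W t).
have phitau : phi tau = phi T.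
  by rewrite /phi zT dot0l ztau dotZl ortho mulr0.
(* The control acts along the costate, hence orthogonally to [W], and drops out of the
   derivative. *)
have dphi t : tau < t < T -> is_derive t 1 phi (dot (z t) (S *m W t)).
  move=> /andP[taut tT]; have t0 := lt_trans tau0 taut.
  have dz : mderiv z (A *m z t + B *m bang zt t) t.
    by apply: mderiv_trajectory => //; apply: cvg_bang; apply: q0; rewrite !ltW.
  apply: (is_derive_eq (is_derive_dot dz (dW t))).
  rewrite dotDl Bb dotZl ortho mulr0 addr0 dot_mulmxl -dotDr /S mulmxDl.
  by rewrite addrC.
have cphi : continuous phi.
  move=> t; apply: cvg_dot; apply: mcont_continuous => //.
  exact: mcont_trajectory.
have [] := @Rolle R phi tau T tauT _ _ phitau.
- by move=> t; rewrite in_itv /= => tt; have [] := dphi t tt.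
- exact: continuous_subspaceT.
move=> s; rewrite in_itv /= => ts [_ e2].
have [_ e1] := dphi s ts.
have e : dot (z s) (S *m W s) = 0 := etrans (esym e1) e2.
case/andP: ts => taus sT.
have hTs : T - s < d by rewrite ltrBlDr -ltrBlDl (lt_trans taud).
have := Hd s; rewrite dotZl e mulr0 eqxx /= gtr0_norm ?subr_gt0// => Hs.
by have := Hs hTs sT.
Qed.

End TruncationIsotropy.


(** * Scalar symmetric part and the spectrum *)

Lemma quad_of_sym (R : realType) (n : nat) (A : 'M[R]_n) (a : R) (x : 'cV[R]_n) :
  A + A^T = (2 * a)%:M -> dot x (A *m x) = a * dot x x.
Proof.
move=> hS; have := congr1 (fun M => dot x (M *m x)) hS.
rewrite mulmxDl dotDr mul_scalar_mx dotZr.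
rewrite [dot x (A^T *m x)]dot_mulmxr trmxK (dotC (A *m x)); lra.
Qed.

(** For a left eigenvector with real and imaginary parts [x] and [y], adding the quadratic forms of
    [A^T] at [x] and at [y] cancels the imaginary part of the eigenvalue and shows that its real
    part is [a]. *)
Lemma spectrum_rate_le0 (R : realType) (n : nat) (A : 'M[R]_n) (a : R) :
  (0 < n)%N -> spectrum_nonpos A -> A + A^T = (2 * a)%:M -> a <= 0.
Proof.
move=> n0 hA hS; pose A' := map_mx (real_complex R) A.
have [l hl] : exists l, root (char_poly A') l.
  by apply/closed_rootP; rewrite size_char_poly eqSS -lt0n.
have el : eigenvalue A' l by rewrite eigenvalue_root_char.
apply: le_trans (hA l el).
have /eigenvalueP[v vA v0] := el.
pose x : 'cV[R]_n := \col_i complex.Re (v 0 i).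
pose y : 'cV[R]_n := \col_i complex.Im (v 0 i).
have ReS (I : finType) (F : I -> complex R) :
    complex.Re (\sum_i F i) = \sum_i complex.Re (F i).
  by apply: (big_morph (@complex.Re R)) => // [[? ?] [? ?]].
have ImS (I : finType) (F : I -> complex R) :
    complex.Im (\sum_i F i) = \sum_i complex.Im (F i).
  by apply: (big_morph (@complex.Im R)) => // [[? ?] [? ?]].
have Ax : A^T *m x = complex.Re l *: x - complex.Im l *: y.
  apply/matrixP => j k; have := congr1 (fun M : 'rV_n => complex.Re (M 0 j)) vA.
  rewrite !mxE ReS; case: l {hl el vA} => lr li /= => h.
  transitivity (complex.Re ((lr +i* li)%C * v 0 j)); last by case: (v 0 j).
  rewrite -h; apply: eq_bigr => i _; rewrite !mxE.
  by case: (v 0 i) => vr vi /=; ring.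
have Ay : A^T *m y = complex.Im l *: x + complex.Re l *: y.
  apply/matrixP => j k; have := congr1 (fun M : 'rV_n => complex.Im (M 0 j)) vA.
  rewrite !mxE ImS; case: l {hl el vA Ax} => lr li /= => h.
  transitivity (complex.Im ((lr +i* li)%C * v 0 j)); last first.
    by case: (v 0 j) => vr vi /=; ring.
  rewrite -h; apply: eq_bigr => i _; rewrite !mxE.
  by case: (v 0 i) => vr vi /=; ring.
have hS' : A^T + (A^T)^T = (2 * a)%:M by rewrite trmxK addrC.
have hx := quad_of_sym x hS'; have hy := quad_of_sym y hS'.
have xy : 0 < dot x x + dot y y.
  have [x0|x0] := eqVneq x 0; last first.
    by rewrite ltr_pwDl ?dotvv_ge0// lt_def dotvv_eq0 x0 dotvv_ge0.
  have y0 : y != 0.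
    apply: contra v0 => /eqP y0; apply/eqP/matrixP => i j; rewrite (ord1 i) mxE.
    have := congr1 (fun M : 'cV_n => M j 0) x0.
    have := congr1 (fun M : 'cV_n => M j 0) y0.
    by rewrite !mxE; case: (v 0 j) => /= ? ? -> ->.
  by rewrite ltr_wpDl ?dotvv_ge0// lt_def dotvv_eq0 y0 dotvv_ge0.
have : a * (dot x x + dot y y) = complex.Re l * (dot x x + dot y y).
  move: hx hy; rewrite Ax Ay dotBr dotDr !dotZr (dotC y x) => hx hy.
  by rewrite !mulrDr -hx -hy; ring.
by move=> /(mulIf (lt0r_neq0 xy)) ->.
Qed.

(** * A radial value function forces isotropy *)

Section RadialIsotropy.
Context {R : realType} {n m : nat} (A : 'M[R]_n) (B : 'M[R]_(n, m)).
Local Notation Q := (switching A B).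
Local Notation swint := (swint A B).

Lemma swint_lt_fun xi xi' T : 0 < T ->
  (forall s, 0 < s <= T -> enorm (Q xi' s) < enorm (Q xi s)) ->
  swint xi' T < swint xi T.
Proof.
move=> T0 h.
have lQ zt := locbd_enorm_switching A B zt.
rewrite -subr_gt0 -intgB//; apply: (@intg_gt0 _ _ T) => //.
- by rewrite T0 lexx.
- exact: locbdB.
- by move=> s /andP[s0 sT]; rewrite subr_ge0 ltW// h// s0 ltW.
- by rewrite subr_gt0 h// T0 lexx.
- apply: cvg_at_left_filter.
  by apply: cvgB; apply: cvg_enorm; exact: cvg_switching.
Qed.

(* [start xi T] has value [T], hence so has the point [y] of the same norm in the
   direction [xi']; bound both norms by duality. *)
Lemma radial_swint_le (xi xi' : 'cV[R]_n) T : radial_value A B ->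
  enorm xi = 1 -> enorm xi' = 1 -> 0 < T -> Q xi T != 0 ->
  swint xi T <= swint xi' T.
Proof.
move=> [Psi [_ _ VPsi]] x1 x1' T0 q0.
set x := start A B xi T; have x0 : x != 0 by exact: start_neq0.
have Vx : Psi (enorm x) = T.
  by rewrite -VPsi /V0 (negbTE x0) opt_time_start.
pose y := enorm x *: xi'.
have yn : enorm y = enorm x by rewrite enormZ x1' mulr1 ger0_norm ?enorm_ge0.
have y0 : y != 0 by rewrite -enorm_gt0 yn enorm_gt0.
have Vy : opt_time A B 0 y = T.
  by have := VPsi y; rewrite /V0 (negbTE y0) yn Vx.
apply: (@le_trans _ _ (enorm x)).
  rewrite -dot_start; apply: le_trans (cauchy_schwarz _ _) _.
  by rewrite x1 mul1r.
have ub s : T < s -> enorm x <= swint xi' s.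
  move=> Ts; move: Vy; rewrite /opt_time; set S := [set _ | _] => Vy.
  have S0 : S !=set0.
    apply/set0P/eqP => S0; move: Vy; rewrite S0 inf0 => T00.
    by move: T0; rewrite -T00 ltxx.
  have := @inf_lt R S s S0; rewrite Vy => /(_ Ts)[t [t0 [v [av sv]]] ts].
  have := steers_dual xi' (ltW t0) av sv.
  rewrite /y dotZr -sqr_enorm x1' expr1n mulr1 mul0r add0r => /le_trans; apply.
  by apply: swint_le; rewrite !ltW.
have c : swint xi' s @[s --> T^'+] --> swint xi' T.
  apply: cvg_at_right_filter; apply: continuous_intg.
  exact: locbd_enorm_switching.
apply: (cvgr_to_ge c); near=> s; apply: ub; near: s; exact: nbhs_right_gt.
Unshelve. all: by end_near. Qed.

(** A strict inequality right after 0 would integrate to one against [radial_swint_le]; it also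
    supplies the nonvanishing required there. *)
Lemma radial_swint_near (xi xi' : 'cV[R]_n) : radial_value A B ->
  enorm xi = 1 -> enorm xi' = 1 ->
  ~ \forall s \near 0^'+, enorm (Q xi' s) < enorm (Q xi s).
Proof.
move=> rad x1 x1' [r /= r0 H].
have T0 : 0 < r / 2 by rewrite divr_gt0.
have lt s : 0 < s <= r / 2 -> enorm (Q xi' s) < enorm (Q xi s).
  move=> /andP[s0 sr]; apply: H => //=; rewrite sub0r normrN gtr0_norm//.
  by apply: le_lt_trans sr _; rewrite ltr_pdivrMr// ltr_pMr// ltr1n.
have q0 : Q xi (r / 2) != 0.
  rewrite -enorm_gt0; apply: le_lt_trans (enorm_ge0 (Q xi' (r / 2))) _.
  by apply: lt; rewrite T0 lexx.
have := radial_swint_le rad x1 x1' T0 q0.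
by rewrite leNgt swint_lt_fun.
Qed.

Lemma radial_enorm_tr (xi xi' : 'cV[R]_n) : radial_value A B ->
  enorm xi = 1 -> enorm xi' = 1 -> enorm (B^T *m xi) <= enorm (B^T *m xi').
Proof.
move=> rad x1 x1'; rewrite leNgt; apply/negP => lt.
apply: (radial_swint_near rad x1 x1').
have c zt : enorm (Q zt s) @[s --> 0^'+] --> enorm (B^T *m zt).
  rewrite -(switching0 A); apply: cvg_at_right_filter; apply: cvg_enorm.
  exact: cvg_switching.
have := lt; rewrite -subr_gt0 => lt0.
have h := cvgr_gt _ (cvgB (c xi) (c xi')) _ lt0.
by apply: filterS (h _ _) => s; rewrite subr_gt0.
Qed.

(** For unit covectors [|Q|^2] always starts at [beta], so the derivatives at 0,
    [- 2 beta <xi, A xi>], decide the comparison. Squaring avoids differentiating a norm. *)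
Lemma radial_quad (xi xi' : 'cV[R]_n) beta : radial_value A B ->
  0 < beta -> B *m B^T = beta%:M ->
  enorm xi = 1 -> enorm xi' = 1 -> dot xi' (A *m xi') <= dot xi (A *m xi).
Proof.
move=> rad beta0 BB x1 x1'; rewrite leNgt; apply/negP => lt.
apply: (radial_swint_near rad x1 x1').
pose f zt s := dot (Q zt s) (Q zt s).
have df (zt : 'cV[R]_n) : is_derive (0 : R) (1 : R) (f zt)
    (- (2 * beta) * dot zt (A *m zt)).
  have dQ := mderiv_switching A B zt 0.
  apply: (is_derive_eq (is_derive_dot dQ dQ)).
  rewrite dotNl dotNr (dotC (Q zt 0)) !switching0 dot_mulmxl trmxK mulmxA BB.
  rewrite mul_scalar_mx dotZr dot_mulmxl trmxK; ring.
have f0 zt : enorm zt = 1 -> f zt 0 = beta.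
  move=> z1; rewrite /f !switching0 dot_mulmxl trmxK mulmxA BB mul_scalar_mx.
  by rewrite dotZr -sqr_enorm z1 expr1n mulr1.
have c zt : enorm zt = 1 -> (f zt s - beta) / s @[s --> 0^'+] -->
    - (2 * beta) * dot zt (A *m zt).
  move=> z1; have := cvg_dnbhs_at_right (is_derive_quotient (df zt)).
  by rewrite f0//; under eq_fun do rewrite subr0.
have lim0 : 0 < - (2 * beta) * dot xi (A *m xi) - - (2 * beta) * dot xi' (A *m xi').
  by rewrite -mulrBr nmulr_rgt0 ?oppr_lt0 ?mulr_gt0// subr_lt0.
have h : \forall s \near 0^'+, 0 < (f xi s - beta) / s - (f xi' s - beta) / s.
  exact: cvgr_gt _ (cvgB (c xi x1) (c xi' x1')) _ lim0.
near=> s.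
have s0 : 0 < s by near: s; exact: nbhs_right_gt.
have : 0 < (f xi s - beta) / s - (f xi' s - beta) / s by near: s.
rewrite -mulrBl pmulr_lgt0 ?invr_gt0// opprB addrA subrK subr_gt0.
by rewrite /f -!sqr_enorm ltr_pXn2r// nnegrE enorm_ge0.
Unshelve. all: by end_near. Qed.

Lemma unit_quad (F : 'cV[R]_n -> R) (c : R) :
  (forall a x, F (a *: x) = a ^+ 2 * F x) ->
  (forall x, enorm x = 1 -> F x = c) -> forall x, F x = c * dot x x.
Proof.
move=> Fh Fc x; have [->|x0] := eqVneq x 0.
  by rewrite dot0l mulr0 -(scale0r 0) Fh expr0n mul0r.
have e : x = enorm x *: ((enorm x)^-1 *: x).
  by rewrite scalerA mulfV ?scale1r// enorm_eq0.
by rewrite {1}e Fh Fc ?enorm_normalized// sqr_enorm mulrC.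
Qed.

Lemma radial_isotropic : (0 < n)%N -> \rank (kalman A B) = n ->
  spectrum_nonpos A -> radial_value A B -> isotropic A B.
Proof.
move=> n0 rk hA rad.
pose e : 'cV[R]_n := delta_mx (Ordinal n0) 0.
have e0 : e != 0.
  apply/eqP => /(congr1 (fun v : 'cV_n => v (Ordinal n0) 0)).
  by rewrite !mxE !eqxx => /eqP; rewrite oner_eq0.
pose u := (enorm e)^-1 *: e.
have u1 : enorm u = 1 by exact: enorm_normalized.
have u0 : u != 0 by rewrite -enorm_gt0 u1.
have Bu x : enorm x = 1 -> enorm (B^T *m x) = enorm (B^T *m u).
  by move=> x1; apply/eqP; rewrite eq_le !radial_enorm_tr.
pose beta := enorm (B^T *m u) ^+ 2.
have Bq x : dot x (B *m B^T *m x) = beta * dot x x.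
  apply: (@unit_quad (fun x => dot x (B *m B^T *m x))) => {x} [a x|x x1].
    by rewrite -scalemxAr dotZl dotZr mulrA expr2.
  by rewrite -mulmxA dot_mulmxr -sqr_enorm Bu.
have BB : B *m B^T = beta%:M.
  by apply: scalar_mx_of_quad => //; rewrite trmx_mul trmxK.
(* If [beta] were 0, [Bq] would make [B^T] vanish on all vectors, and the rank condition would force
   [u = 0]. *)
have beta0 : 0 < beta.
  rewrite exprn_gt0// enorm_gt0; apply: contra u0 => /eqP Bu0.
  have B0 (x : 'cV[R]_n) : B^T *m x = 0.
    apply/eqP; rewrite -dotvv_eq0 dot_mulmxl trmxK mulmxA Bq /beta Bu0.
    by rewrite enorm0 expr0n mul0r.
  by apply/eqP; apply: (ker_kalman rk) => // eta _; exact: B0.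
pose a := dot u (A *m u).
have Aq x : dot x (A *m x) = a * dot x x.
  apply: (@unit_quad (fun x => dot x (A *m x))) => {x} [c x|x x1].
    by rewrite -scalemxAr dotZl dotZr mulrA expr2.
  by apply/eqP; rewrite eq_le !(radial_quad rad beta0 BB).
have AA : A + A^T = (2 * a)%:M.
  apply: scalar_mx_of_quad => [|x]; first by rewrite linearD /= trmxK addrC.
  by rewrite mulmxDl dotDr (dot_mulmxr A^T) trmxK (dotC (A *m x)) Aq; ring.
by exists beta, a; split=> //; exact: spectrum_rate_le0 AA.
Qed.

Lemma truncation_isotropic : (0 < n)%N -> \rank (kalman A B) = n ->
  spectrum_nonpos A -> exact_truncation A B -> isotropic A B.
Proof.
move=> n0 rk hA htr; have [beta [beta0 BB]] := truncation_BBt n0 rk htr.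
have [c hc] := scalar_mx_of_ortho (truncation_skew htr beta0 BB).
have AA : A + A^T = (2 * (c / 2))%:M by rewrite hc mulrC divfK.
by exists beta, (c / 2); split=> //; exact: spectrum_rate_le0 AA.
Qed.

End RadialIsotropy.

(** * Isotropic systems *)

Section IsotropicSystems.
Context {R : realType} {n m : nat} (A : 'M[R]_n) (B : 'M[R]_(n, m)).
Context (beta a : R) (beta0 : 0 < beta) (a0 : a <= 0).
Context (BB : B *m B^T = beta%:M) (AA : A + A^T = (2 * a)%:M).
Local Notation E := (expmx A).
Local Notation Q := (switching A B).
Local Notation bang := (bang A B).
Local Notation swint := (swint A B).
Local Notation traj := (trajectory A B).
Local Notation b := (Num.sqrt beta).

Lemma is_derive_expR_scale (c t : R) :
  is_derive t 1 (fun s => expR (c * s)) (c * expR (c * t)).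
Proof.
have h : is_derive t (1 : R) (fun s : R => c * s) c.
  have := is_deriveZ c (is_derive_id t (1 : R)).
  by move=> H; apply: (is_derive_eq H); rewrite /GRing.scale /= mulr1.
have := @is_derive1_comp R expR (fun s : R => c * s) t _ _ (is_derive_expR _) h.
by move=> H; apply: (is_derive_eq H); rewrite mulrC.
Qed.

Lemma isotropic_dot_expmx (y : 'cV[R]_n) t :
  dot (E t *m y) (E t *m y) = expR (2 * a * t) * dot y y.
Proof.
pose f s := dot (E s *m y) (E s *m y).
have df (s : R) : is_derive s (1 : R) f (2 * a * f s).
  have dE : mderiv (fun r => E r *m y) (A *m (E s *m y)) s.
    have := mderivM (mderiv_expmx A s) (mderiv_cst y s).
    by rewrite mulmx0 addr0 mulmxA.
  apply: (is_derive_eq (is_derive_dot dE dE)).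
  rewrite (dotC (A *m _)) (quad_of_sym _ AA) -/(f s); ring.
have dg (s : R) : is_derive s (1 : R) (fun s => expR (- (2 * a) * s) * f s) 0.
  apply: (is_derive_eq (is_deriveM (is_derive_expR_scale _ s) (df s))).
  by rewrite /GRing.scale /=; ring.
have := is_derive_0_is_cst t 0 dg.
rewrite mulr0 expR0 mul1r /f expmx0 mul1mx => <-.
by rewrite mulrA -expRD mulNr subrr expR0 mul1r.
Qed.

(** [E t] is [expR (a * t)] times an orthogonal matrix, so costate and free motion issued from the
    same vector stay parallel. *)
Lemma isotropic_trE t : (E (- t))^T = expR (- (2 * a) * t) *: E t.
Proof.
have h : (E t)^T *m E t = (expR (2 * a * t))%:M.
  apply: scalar_mx_of_quad => [|x]; first by rewrite trmx_mul trmxK.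
  by rewrite -mulmxA dot_mulmxr trmxK isotropic_dot_expmx.
have : (E (- t))^T *m (E t)^T *m E t = E t.
  by rewrite -trmx_mul expmxKN trmx1 mul1mx.
rewrite -mulmxA h mul_mx_scalar => <-.
by rewrite scalerA -expRD mulNr addNr expR0 scale1r.
Qed.

Lemma isotropic_enorm_expmx (y : 'cV[R]_n) t :
  enorm (E t *m y) = expR (a * t) * enorm y.
Proof.
rewrite enormE isotropic_dot_expmx -[2 * a * t]mulrA expRM_natl.
by rewrite sqrtrM ?sqr_ge0// sqrtr_sqr ger0_norm ?expR_ge0// -enormE.
Qed.

Lemma isotropic_enorm_costate (x : 'cV[R]_n) t :
  enorm ((E (- t))^T *m x) = expR (- a * t) * enorm x.
Proof.
rewrite isotropic_trE -scalemxAl enormZ isotropic_enorm_expmx.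
rewrite ger0_norm ?expR_ge0// mulrA -expRD; congr (expR _ * _); ring.
Qed.

Lemma isotropic_enorm_switching (x : 'cV[R]_n) t :
  enorm (Q x t) = b * expR (- a * t) * enorm x.
Proof.
rewrite -mulrA -isotropic_enorm_costate !enormE -sqrtrM ?ltW//; congr Num.sqrt.
rewrite /switching trmx_mul -mulmxA dot_mulmxl trmxK mulmxA BB mul_scalar_mx.
by rewrite dotZr.
Qed.

Definition expint (t : R) : R := intg (fun s => expR (- a * s)) t.

Lemma continuous_expR_scale (c : R) : continuous (fun s : R => expR (c * s)).
Proof.
move=> t; apply/differentiable_continuous/derivable1_diffP.
by case: (is_derive_expR_scale c t).
Qed.

Lemma locbd_expR : locbd (fun s => expR (- a * s)).
Proof. exact/locbd_continuous/continuous_expR_scale. Qed.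

(** The integrand is at least 1 because [a <= 0]; this yields strict monotonicity and unboundedness
    at once. *)
Lemma expint_growth s t : 0 <= s <= t -> t - s <= expint t - expint s.
Proof.
move=> st; rewrite -[leLHS]mul1r; apply: ge_intg => //; first exact: locbd_expR.
move=> r /andP[sr _]; rewrite -expR0 ler_expR mulr_ge0 ?oppr_ge0//.
by case/andP: st => s0 _; rewrite (le_trans s0)// ltW.
Qed.

Lemma isotropic_swint (x : 'cV[R]_n) t : swint x t = b * enorm x * expint t.
Proof.
rewrite -intgZ; last exact: locbd_expR.
by apply: eq_intg => s _; rewrite isotropic_enorm_switching mulrAC.
Qed.

Lemma sqrt_beta : b ^+ 2 = beta. Proof. by rewrite sqr_sqrtr// ltW. Qed.

(** The point [x] serves as its own costate: after removal of the free motion, the velocity at time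
    [s] is [- b expR (- a * s)] along the unit vector of [x]. *)
Lemma isotropic_trajectory (x : 'cV[R]_n) t : x != 0 ->
  traj x (bang x) t = (1 - b * expint t / enorm x) *: (E t *m x).
Proof.
move=> x0; have nx : enorm x != 0 by rewrite enorm_eq0.
have b0 : b != 0 by rewrite gt_eqF// sqrtr_gt0.
rewrite /trajectory scalemxAr; congr (_ *m _).
rewrite scalerBl scale1r; congr (_ + _); apply: dot_inj => y.
rewrite dot_vintg; last by apply: vlocbd_integrand; exact: nice_bang.
rewrite dotNr dotZr.
rewrite (_ : - (_ * _) = (- (b / enorm x * dot y x)) * expint t); last by ring.
rewrite -intgZ; last exact: locbd_expR.
apply: eq_intg => s _.
rewrite /bang mulmxN -scalemxAr isotropic_enorm_switching.
rewrite {1}/switching trmx_mul -!mulmxA [B *m _]mulmxA BB mul_scalar_mx.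
rewrite -scalemxAr isotropic_trE -scalemxAl -scalemxAr mulmxA expmxNK mul1mx.
rewrite dotNr !dotZr.
have := sqrt_beta; move: (b) b0 => r r0 <-.
rewrite [- (2 * a) * s](_ : _ = - a * s + - a * s); last by ring.
rewrite expRD; have e0 : expR (- a * s) != 0 by rewrite gt_eqF// expR_gt0.
by field; rewrite nx e0 r0.
Qed.

Lemma isotropic_switching_neq0 (x : 'cV[R]_n) t : x != 0 -> Q x t != 0.
Proof.
move=> x0; rewrite -enorm_gt0 isotropic_enorm_switching.
apply: mulr_gt0; last by rewrite enorm_gt0.
by apply: mulr_gt0; [rewrite sqrtr_gt0|exact: expR_gt0].
Qed.

Lemma isotropic_hitting_time eps r : 0 <= eps < r -> exists T,
  0 < T /\ r = b * expint T + eps * expR (- a * T).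
Proof.
move=> /andP[e0 er]; have r0 : 0 < r by apply: le_lt_trans er.
have b0 : 0 < b by rewrite sqrtr_gt0.
pose f t := b * expint t + eps * expR (- a * t).
have cf : continuous f.
  move=> t; apply: cvgD; (apply: cvgM; first exact: cvg_cst).
    by apply: continuous_intg; exact: locbd_expR.
  exact: continuous_expR_scale.
have f0 : f 0 = eps by rewrite /f /expint intg_le0// !mulr0 expR0 mulr1 add0r.
have rb0 : 0 <= r / b by rewrite divr_ge0// ltW.
(* [expint t] is at least [t], so [r / b] is an upper end for the intermediate value theorem. *)
have frb : r <= f (r / b).
  have := expint_growth (s := 0) (t := r / b); rewrite lexx rb0 => /(_ isT).
  rewrite subr0 {2}/expint intg_le0// subr0 ler_pdivrMr// mulrC => h.
  by rewrite /f (le_trans h)// lerDl mulr_ge0// expR_ge0.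
have [T] : exists2 T, T \in `[0, r / b] & f T = r.
  apply: IVT => //; first exact: continuous_subspaceT.
  by rewrite f0 ge_min le_max (ltW er) frb orbT.
rewrite in_itv /= => /andP[T0 _] fT; exists T; split=> //.
rewrite lt_neqAle T0 andbT; apply/eqP => T0'.
by move: fT er; rewrite -T0' f0 => ->; rewrite ltxx.
Qed.

(* The trajectory shrinks along [E t *m x]; its final time is the [T] at which the
   norm [exp(a t) (|x| - b expint t)] reaches [eps]. *)
Lemma isotropic_optimal eps (x : 'cV[R]_n) : 0 <= eps < enorm x -> exists T,
  [/\ 0 < T, enorm x = b * expint T + eps * expR (- a * T),
    opt_time A B eps x = T &
    forall t, 0 < t <= T -> opt_control A B eps x t = bang x t].
Proof.
move=> er; have [T [T0 xT]] := isotropic_hitting_time er.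
case/andP: (er) => e0 _; have nx : 0 < enorm x by case/andP: er => ?; apply: le_lt_trans.
have x0 : x != 0 by rewrite -enorm_gt0.
have b0 : 0 < b by rewrite sqrtr_gt0.
have nb := nice_bang A B x.
have zE : 1 - b * expint T / enorm x = eps * expR (- a * T) / enorm x.
  transitivity ((enorm x - b * expint T) / enorm x).
    by rewrite mulrBl mulfV ?gt_eqF.
  by rewrite {1}xT addrC addKr.
have zT : enorm (traj x (bang x) T) = eps.
  rewrite isotropic_trajectory// zE enormZ isotropic_enorm_expmx.
  rewrite ger0_norm; last by rewrite !mulr_ge0 ?expR_ge0// invr_ge0 ltW.
  have ee : expR (- a * T) * expR (a * T) = 1 by rewrite -expRD mulNr addNr expR0.
  transitivity (eps * (expR (- a * T) * expR (a * T)) * ((enorm x)^-1 * enorm x)).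
    by ring.
  by rewrite ee mulVf ?gt_eqF// !mulr1.
have TE : opt_time A B eps x = T.
  apply: (@opt_timeE _ _ _ A B eps x x (bang x)) => //; first by rewrite zT.
  (* Divided by [enorm x], the dual inequality compares the strictly increasing function
     [b * expint t + eps * expR (- a * t)] with its value at [T]. *)
  move=> t /andP[t0 tT]; rewrite isotropic_swint isotropic_enorm_costate.
  rewrite -sqr_enorm expr2.
  rewrite (_ : _ + _ = enorm x * (b * expint t + eps * expR (- a * t))); last by ring.
  rewrite ltr_pM2l// xT; apply: ltr_leD.
    rewrite ltr_pM2l// -subr_gt0; apply: (@lt_le_trans _ _ (T - t)).
      by rewrite subr_gt0.
    by apply: expint_growth; rewrite !ltW.
  by rewrite ler_wpM2l// ler_expR ler_wpM2l ?oppr_ge0// ltW.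
have dT : dot x (E (- T) *m traj x (bang x) T) = eps * enorm ((E (- T))^T *m x).
  rewrite isotropic_trajectory// -scalemxAr mulmxA expmxNK mul1mx dotZr zE.
  by rewrite isotropic_enorm_costate -sqr_enorm expr2; field; rewrite gt_eqF.
have q0 t : Q x t != 0 by exact: isotropic_switching_neq0.
exists T; split=> // t tT.
(* [T / 2] is a fictitious switching time, serving to obtain a representative. As [Q] never
   vanishes, [opt_repr_eq_bang] then covers every time, [T / 2] included. *)
have [ov _] : opt_repr A B eps x (opt_control A B eps x) /\ forall t, 0 < t <= T ->
    t != T / 2 -> opt_control A B eps x t = bang x t.
  have := @opt_control_bang _ _ _ A B eps x x (T / 2)
    (bang x (T / 2)) (bang x (T / 2)) e0.
  rewrite /= TE; apply.
  - by rewrite zT.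
  - exact: dT.
  - by apply/andP; split; [rewrite divr_gt0|rewrite ltr_pdivrMr// ltr_pMr// ltr1n].
  - by move=> s _ _; exact: q0.
  - exact: nb.2.
  - exact/cvg_at_left_filter/cvg_bang.
  - exact/cvg_at_right_filter/cvg_bang.
have := opt_repr_eq_bang e0 _ ov; rewrite TE => /(_ x dT); apply => //.
Qed.

Lemma expint_inj s t : 0 <= s -> 0 <= t -> expint s = expint t -> s = t.
Proof.
wlog st : s t / s <= t.
  move=> H s0 t0 e; have [st|/ltW ts] := leP s t; first exact: H.
  by apply/esym/H.
move=> s0 _ e; apply/eqP; rewrite eq_le st /= -subr_le0.
by have := expint_growth (s := s) (t := t); rewrite s0 st e subrr => /(_ isT).
Qed.

(** Both optimal controls are [bang x] on their own intervals, so it remains to see that the ball is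
    not reached later than the origin; compare the two hitting equations through [expint]. *)
Lemma isotropic_truncation_at (x : 'cV[R]_n) eps : 0 < eps < enorm x ->
  truncation_at A B x eps.
Proof.
move=> /andP[e0 ex] t; have b0 : 0 < b by rewrite sqrtr_gt0.
have [|T [T0 xT TE cT]] := isotropic_optimal (eps := eps) (x := x).
  by rewrite ltW.
have [|T' [T'0 xT' T'E cT']] := isotropic_optimal (eps := 0) (x := x).
  by rewrite lexx (lt_trans e0).
rewrite TE => /andP[t0 tT]; rewrite cT ?t0// cT' ?t0//=; apply: le_trans tT _.
rewrite leNgt; apply/negP => TT'.
have h : T - T' <= expint T - expint T' by apply: expint_growth; rewrite !ltW.
have : expint T <= expint T'.
  rewrite -(ler_pM2l b0); move: xT'; rewrite mul0r addr0 => <-.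
  by rewrite xT lerDl mulr_ge0 ?expR_ge0// ltW.
rewrite -subr_le0 => h2; have := le_trans h h2.
by rewrite subr_le0 leNgt TT'.
Qed.

Lemma isotropic_radial : (0 < n)%N -> radial_value A B.
Proof.
move=> n0; pose e : 'cV[R]_n := delta_mx (Ordinal n0) 0.
have e0 : e != 0.
  apply/eqP => /(congr1 (fun v : 'cV_n => v (Ordinal n0) 0)).
  by rewrite !mxE !eqxx => /eqP; rewrite oner_eq0.
pose u := (enorm e)^-1 *: e.
have u1 : enorm u = 1 by exact: enorm_normalized.
(* The profile is the value function along one fixed ray; the hitting equation at radius 0 involves
   [x] through its norm alone. *)
exists (fun r => V0 A B (r *: u)); split=> [r _||x].
- by rewrite /V0; case: ifP => // _; exact: opt_time_ge0.
- by rewrite scale0r /V0 eqxx.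
- have [->|x0] := eqVneq x 0; first by rewrite enorm0 scale0r.
  set y := _ *: u; have yx : enorm y = enorm x.
    by rewrite enormZ u1 mulr1 ger0_norm ?enorm_ge0.
  have y0 : y != 0 by rewrite -enorm_gt0 yx enorm_gt0.
  rewrite /V0 (negbTE x0) (negbTE y0).
  have [|T [T0 xT -> _]] := isotropic_optimal (eps := 0) (x := x).
    by rewrite lexx enorm_gt0.
  have [|T' [T'0 yT' -> _]] := isotropic_optimal (eps := 0) (x := y).
    by rewrite lexx enorm_gt0.
  apply: expint_inj; rewrite ?ltW//.
  have b0 : b != 0 by rewrite gt_eqF// sqrtr_gt0.
  by apply: (mulfI b0); move: xT; rewrite -yx yT' !mul0r !addr0.
Qed.

End IsotropicSystems.

Theorem theorem1p1 (R : realType) (n m : nat)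
    (A : 'M[R]_n) (B : 'M[R]_(n, m))
    (hn : (1 <= n)%N) (hm : (1 <= m)%N)
    (hA : spectrum_nonpos A)
    (hAB : \rank (kalman A B) = n) :
  [/\ exact_truncation A B <-> isotropic A B,
      isotropic A B <-> radial_value A B
    & exact_truncation A B \/ isotropic A B \/ radial_value A B ->
      forall (x : 'cV[R]_n) (eps : R), x != 0 -> 0 < eps < enorm x ->
        truncation_at A B x eps].
Proof.
have iso_tr : isotropic A B -> forall (x : 'cV[R]_n) (eps : R),
    0 < eps < enorm x -> truncation_at A B x eps.
  move=> [beta [a [beta0 a0 BB AA]]] x eps.
  exact: (isotropic_truncation_at beta0 a0 BB AA).
have tr_iso : exact_truncation A B -> isotropic A B.
  exact: truncation_isotropic.
have rad_iso : radial_value A B -> isotropic A B.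
  exact: radial_isotropic.
split.
- split=> // iso x x0; exists (enorm x / 2).
  have nx : 0 < enorm x by rewrite enorm_gt0.
  split=> [|eps /andP[e0 ex]]; first by apply/andP; split; lra.
  by apply: iso_tr => //; apply/andP; split; lra.
- split=> // [[beta [a [beta0 a0 BB AA]]]].
  exact: (isotropic_radial beta0 a0 BB AA hn).
- move=> h x eps _ ex; apply: iso_tr => //.
  by case: h => [/tr_iso|[|/rad_iso]].
Qed.
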